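(* (Colored Burke's theorem.) Let $n\ge1$, $q\in[0,1)$, $\alpha_1>\alpha_2>\dots>\alpha_n>0$, $\nu_i\in[0,\alpha_i]$. Let $\mathbb W^{(-m),\mathrm{queue}}_{\xi,\alpha_m,\nu_m}$ ($1\le m\le n$) and $W^{\mathrm{qp}}_\xi$ be nonnegative stochastic vertex weights satisfying, together with $\mathbb W^{(-m),\mathrm{line}}_{\alpha_m,\nu_m}$, the Yang--Baxter equation stated in the context for each $m$. Let $\mathbf d=(d(0),d(-1),\dots)$, $\mathbf V=(\mathbf V(1),\mathbf V(2),\dots)$ be the random boundary data and $d'(-i)$, $\mathbf V'(j)$ the random edge configurations defined in the context. Then $$\Bigl\{(d(-i))_{i\ge0},\,(\mathbf V(j))_{j\ge1}\Bigr\}\stackrel d=\Bigl\{(d'(-i))_{i\ge0},\,(\mathbf V(j))_{j\ge2}\Bigr\}\stackrel d=\Bigl\{(d(-i))_{i\ge1},\,(\mathbf V'(j))_{j\ge1}\Bigr\}$$ (equality of joint distributions of the re-indexed sequences). In words: the joint distribution of the vertical and horizontal arrow configurations entering any shifted quadrant $\mathbb Z_{\ge I}\times\mathbb Z_{\ge J+1}$, $I,J\ge0$, is the same as for the quadrant $\mathbb Z_{\ge0}\times\mathbb Z_{\ge1}$.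
   Context: **General conventions.** A vertex weight takes arrow configurations entering from below and from the left (first two arguments) and exiting above and to the right (last two arguments). Stochastic: for fixed inputs the weights sum to $1$ over outputs. All weights obey conservation of the number of arrows of each color. Colors are $1,\dots,n$; $0$ = no arrow. In column $-m$ vertical tuples $\mathbf A$ have $A_m=+\infty$ and other coordinates in $\mathbb Z_{\ge0}$ (conservation of color $m$ is then vacuous). $\mathbf e_i$: standard basis vectors; $A_{[a,b]}=\sum_{i=a}^bA_i$ (zero if $a>b$). **Line weights.** For $k\in\{0\}\cup\{m+1,\dots,n\}$, $\ell\in\{0,\dots,n\}$, $\mathbb W^{(-m),\mathrm{line}}_{\alpha,\nu}(\mathbf A,k;\mathbf C,\ell)$ equals $\frac1{1+\alpha}$ times: - $1$ for $(\mathbf A,0;\mathbf A,0)$ and $(\mathbf A,k;\mathbf A+\mathbf e_k,0)$, $k>m$; - $\alpha(1-q^{A_\ell})q^{A_{[\ell+1,n]}}$ for $(\mathbf A,0;\mathbf A-\mathbf e_\ell,\ell)$, $\ell>m$; - $\alpha q^{A_{[m+1,n]}}$ for $(\mathbf A,0;\mathbf A,m)$; - $\nu q^{A_{[m+1,n]}}$ for $(\mathbf A,k;\mathbf A+\mathbf e_k,m)$, $k>m$; - $(\alpha-\nu q^{A_k})q^{A_{[k+1,n]}}$ for $(\mathbf A,k;\mathbf A,k)$, $k>m$; - $\alpha(1-q^{A_\ell})q^{A_{[\ell+1,n]}}$ for $(\mathbf A,k;\mathbf A+\mathbf e_k-\mathbf e_\ell,\ell)$, $m<k<\ell$; - $\nu(1-q^{A_\ell})q^{A_{[\ell+1,n]}}$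 for $(\mathbf A,k;\mathbf A+\mathbf e_k-\mathbf e_\ell,\ell)$, $m<\ell<k$; and $0$ otherwise. (A color $k<m$ entering from the left stays in the column: $\mathbf C$ gains $\mathbf e_k$ and the rest behaves as for input $0$; the same rule with color $m$ entering. These cases do not occur in the models below.) **Abstract weights and Yang--Baxter equation.** $\mathbb W^{(-m),\mathrm{queue}}_{\xi,\alpha_m,\nu_m}(\mathbf A,\mathbf B;\mathbf C,\mathbf D)$ has horizontal configurations $\mathbf B,\mathbf D\in\mathbb Z_{\ge0}^n$; $W^{\mathrm{qp}}_\xi(k,\mathbf B;\ell,\mathbf D)$ has $k,\ell\in\{0,\dots,n\}$ vertically and $\mathbf B,\mathbf D\in\mathbb Z_{\ge0}^n$ horizontally. The assumed equation: for all fixed $\mathbf A,\mathbf B$ (vertical tuples), $\mathbf I_1,\mathbf J_1\in\mathbb Z_{\ge0}^n$, $i_2,j_2\in\{0,\dots,n\}$, $$\begin{aligned}&\sum_{\mathbf K_1,k_2,\mathbf K_3}\mathbb W^{(-m),\mathrm{line}}_{\alpha_m,\nu_m}(\mathbf A,i_2;\mathbf K_3,k_2)\,\mathbb W^{(-m),\mathrm{queue}}_{\xi,\alpha_m,\nu_m}(\mathbf K_3,\mathbf I_1;\mathbf B,\mathbf K_1)\,W^{\mathrm{qp}}_\xi(k_2,\mathbf K_1;j_2,\mathbf J_1)\\&=\sum_{\mathbf K_1,k_2,\mathbf K_3}W^{\mathrm{qp}}_\xi(i_2,\mathbf I_1;k_2,\mathbf K_1)\,\mathbb W^{(-m),\mathrm{queue}}_{\xi,\alpha_m,\nu_m}(\mathbf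 A,\mathbf K_1;\mathbf K_3,\mathbf J_1)\,\mathbb W^{(-m),\mathrm{line}}_{\alpha_m,\nu_m}(\mathbf K_3,k_2;\mathbf B,j_2).\end{aligned}$$ **The three coupled models.** (i) *Steady state queues.* In the rectangle $\{-n,\dots,-1\}\times\{-K,\dots,0\}$ run the stochastic vertex model with weight $\mathbb W^{(-m),\mathrm{line}}_{\alpha_m,\nu_m}$ at each $(-m,-j)$, no arrows entering from the left, and empty input from below (except for the infinitely many color-$m$ arrows in column $-m$). As $K\to\infty$ the vertical configuration $\mathbf M=(\mathbf M(-n),\dots,\mathbf M(-1))$ exiting at the top and the colors $d(0),d(-1),d(-2),\dots$ exiting to the right from column $-1$ in rows $0,-1,-2,\dots$ converge jointly in distribution; $\mathbf M$ and $\mathbf d$ denote the limits. (ii) *Queue model above.* In $\{-n,\dots,-1\}\times\mathbb Z_{\ge1}$ run the model with weight $\mathbb W^{(-m),\mathrm{queue}}_{\xi,\alpha_m,\nu_m}$ at $(-m,j)$, no arrows from the left, and input $\mathbf M$ from below. $\mathbf V(j)\in\mathbb Z_{\ge0}^n$ is the configuration exiting column $-1$ to the right in row $j\ge1$. (iii) *Quadrant.* In $\mathbb Z_{\ge0}\times\mathbb Z_{\ge1}$ run the stochastic vertex model with weight $W^{\mathrm{qp}}_\xi$ at each $(i,j)$, with $\mathbf V(j)$ entering $(0,j)$ from the left and $d(-i)$ entering $(i,1)$ from below. $\mathbf V'(j)$ is the configuration on the horizontal edge $(0,j)-(1,j)$, $j\ge1$, and $d'(-i)$ the color on the vertical edge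 $(i,1)-(i,2)$, $i\ge0$. *)

(* Defs.v *)
From HB Require Import structures.
From mathcomp Require Import all_boot all_order all_algebra.
From mathcomp Require Import all_classical all_reals all_analysis.

Set Implicit Arguments.
Unset Strict Implicit.
Unset Printing Implicit Defensive.

Import Order.TTheory GRing.Theory Num.Theory.
Import numFieldNormedType.Exports.

Local Open Scope classical_set_scope.
Local Open Scope ring_scope.

(* Colors 1..n are indexed from 0: [Some i] with [i : 'I_n] is color [i + 1],
   and [None] is the absence of an arrow (color 0).  Accordingly [m : 'I_n]
   also denotes the column [-(m + 1)]. *)
Definition color (n : nat) := option 'I_n.

Definition hconf (n : nat) := {ffun 'I_n -> nat}.

Definition hzero (n : nat) : hconf n := [ffun => 0%N].

(* Coordinates of vertical tuples are extended naturals, [None] being +oo. *)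
Definition vconf (n : nat) := {ffun 'I_n -> option nat}.

Definition vertical n (m : 'I_n) (A : vconf n) : Prop :=
  forall i, (A i == None) = (i == m).

Definition vempty n (m : 'I_n) : vconf n :=
  [ffun i => if i == m then None else Some 0%N].

(* [A + e_k] and [A - e_k]; the color [None] contributes nothing, and an
   infinite coordinate is unchanged. *)
Definition add_arrow n (A : vconf n) (k : color n) : vconf n :=
  [ffun i => if k == Some i then omap S (A i) else A i].

Definition rem_arrow n (A : vconf n) (k : color n) : vconf n :=
  [ffun i => if k == Some i then omap predn (A i) else A i].

(* Both are used only at finite coordinates: [vcount A i] is A_i and
   [vtail A i] is A_[i+1,n]. *)
Definition vcount n (A : vconf n) (i : 'I_n) : nat := odflt 0%N (A i).

Definition vtail n (A : vconf n) (i : 'I_n) : nat :=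
  (\sum_(j < n | i < j) vcount A j)%N.

Section LineWeights.
Variables (R : realType) (n : nat) (q alpha nu : R) (m : 'I_n).

(* The numerator of the weight with left input [k] and right output [l].  A
   color [k <= m] entering from the left acts here like the input 0. *)
Definition line_coef (A : vconf n) (k l : color n) : R :=
  match l with
  | None => 1
  | Some l =>
    if (l < m)%N then 0 else
    match (if k is Some k then if (m < k)%N then Some k else None else None) with
    | None =>
      if l == m then alpha * q ^+ vtail A m
      else alpha * (1 - q ^+ vcount A l) * q ^+ vtail A l
    | Some k =>
      if l == m then nu * q ^+ vtail A m
      else if l == k then (alpha - nu * q ^+ vcount A k) * q ^+ vtail A k
      else if (k < l)%N then alpha * (1 - q ^+ vcount A l) * q ^+ vtail A l
      else nu * (1 - q ^+ vcount A l) * q ^+ vtail A l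
    end
  end.

(* In every case the outgoing vertical tuple is [A + e_k - e_l]; for [l != k]
   with [A_l = 0] the subtraction is truncated but the coefficient vanishes. *)
Definition line_weight (A : vconf n) (k : color n) (C : vconf n) (l : color n)
    : R :=
  if C == rem_arrow (add_arrow A k) l then (1 + alpha)^-1 * line_coef A k l
  else 0.

End LineWeights.

Definition stochastic_queue_weight (R : realType) n (m : 'I_n)
    (W : vconf n -> hconf n -> vconf n -> hconf n -> R) : Prop :=
  [/\ forall A B C D, vertical m A -> vertical m C -> 0 <= W A B C D,
      forall A B, vertical m A ->
        \esum_(o in [set o : vconf n * hconf n | vertical m o.1])
          (W A B o.1 o.2)%:E = 1%E
    & forall A B C D, vertical m A -> vertical m C -> W A B C D != 0 ->
        forall i, omap (addn (B i)) (A i) = omap (addn (D i)) (C i)].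

Definition stochastic_qp_weight (R : realType) n
    (W : color n -> hconf n -> color n -> hconf n -> R) : Prop :=
  [/\ forall k B l D, 0 <= W k B l D,
      forall k B,
        \esum_(o in [set: color n * hconf n]) (W k B o.1 o.2)%:E = 1%E
    & forall k B l D, W k B l D != 0 ->
        forall i, ((k == Some i) + B i = (l == Some i) + D i)%N].

Definition yang_baxter (R : realType) n (m : 'I_n)
    (Wline : vconf n -> color n -> vconf n -> color n -> R)
    (Wqueue : vconf n -> hconf n -> vconf n -> hconf n -> R)
    (Wqp : color n -> hconf n -> color n -> hconf n -> R) : Prop :=
  forall (A B : vconf n) (I1 J1 : hconf n) (i2 j2 : color n),
    vertical m A -> vertical m B ->
    \esum_(x in [set x : hconf n * color n * vconf n | vertical m x.2])
      (let: (K1, k2, K3) := x in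
       Wline A i2 K3 k2 * Wqueue K3 I1 B K1 * Wqp k2 K1 j2 J1)%:E =
    \esum_(x in [set x : hconf n * color n * vconf n | vertical m x.2])
      (let: (K1, k2, K3) := x in
       Wqp i2 I1 k2 K1 * Wqueue A K1 K3 J1 * Wline K3 k2 B j2)%:E.

(* The vertical configurations of all columns [-n..-1] at a given height. *)
Definition vstate (n : nat) := {ffun 'I_n -> vconf n}.

Section SteadyState.
Variables (R : realType) (n : nat) (q : R) (alpha nu : 'I_n -> R).

(* Edge configurations of the rectangle {-n..-1} x {-K..0}.  If [c] is one,
   [c.1 j] is the vertical configuration just above row [-j], so [c.1 ord0]
   exits at the top and [c.1 ord_max] enters row [-K] from below.  In row [-j],
   [c.2 j p] is the color on the p-th horizontal edge counted from the right:
   column [-(m+1)] has left edge [m+1] and right edge [m], edge [0] being the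
   exit of column -1 and edge [n] the left boundary. *)
Definition line_edges (K : nat) : Type :=
  ({ffun 'I_K.+2 -> vstate n} * {ffun 'I_K.+1 -> {ffun 'I_n.+1 -> color n}})%type.

Definition line_edges_prob K (c : line_edges K) : R :=
  ((c.1 ord_max == [ffun m => vempty m]) &&
   [forall j, c.2 j ord_max == None])%:R *
  \prod_(j < K.+1) \prod_(m < n)
    line_weight q (alpha m) (nu m) m
      (c.1 (lift ord0 j) m) (c.2 j (lift ord0 m))
      (c.1 (widen_ord (leqnSn _) j) m) (c.2 j (widen_ord (leqnSn _) m)).

(* The top configuration and the colors exiting to the right in rows
   [0, -1, ..., -(r-1)]; meaningful for [r <= K + 1]. *)
Definition line_exits K r (c : line_edges K) :
    vstate n * {ffun 'I_r -> color n} :=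
  (c.1 ord0, [ffun i : 'I_r => c.2 (inord i) ord0]).

Definition line_exits_prob K r (S : set (vstate n * {ffun 'I_r -> color n}))
    : \bar R :=
  \esum_(c in [set c : line_edges K | S (line_exits r c)])
    (line_edges_prob c)%:E.

(* [(M, (dd i)_i)] is a limit in distribution, as K -> oo, of the top
   configuration and of the right exits of rows 0, -1, -2, ...  The values of
   any finite part of this sequence lie in a countable discrete space, in
   which every set is a continuity set. *)
Definition steady_state d (Om : measurableType d) (P : probability Om R)
    (M : Om -> vstate n) (dd : nat -> Om -> color n) : Prop :=
  forall r (S : set (vstate n * {ffun 'I_r -> color n})),
    line_exits_prob K S @[K --> \oo] -->
      P [set w | S (M w, [ffun i : 'I_r => dd i w])].

End SteadyState.

(* Edge configurations of the queue model in {-n..-1} x Z_{>=1} together with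
   the quadrant Z_{>=0} x Z_{>=1}.  The row index [j] stands for row [j + 1].
   - [qv m j]: vertical edge entering row [j + 1] from below in column
     [-(m+1)];
   - [qh p j]: p-th horizontal edge of row [j + 1] to the left of the quadrant,
     [p <= n], numbered from the right as in [line_edges];
   - [pv i j]: vertical edge entering [(i, j + 1)] from below;
   - [ph i j]: horizontal edge entering [(i, j + 1)] from the left. *)
Record edges (n : nat) := Edges {
  qv : 'I_n -> nat -> vconf n;
  qh : nat -> nat -> hconf n;
  pv : nat -> nat -> color n;
  ph : nat -> nat -> hconf n }.

Definition admissible n (e : edges n) : Prop :=
  [/\ forall m j, vertical m (qv e m j),
      forall j, qh e n j = hzero n
    & forall j, ph e 0%N j = qh e 0%N j].

(* Agreement on all edges touching the first [s] rows of the queue model or the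
   first [r] columns and [s] rows of the quadrant; for [s = 0] only the bottom
   boundary edges remain. *)
Definition agree n (r s : nat) (e e' : edges n) : Prop :=
  [/\ forall m j, (j <= s)%N -> qv e m j = qv e' m j,
      forall p j, (p <= n)%N -> (j < s)%N -> qh e p j = qh e' p j,
      forall i j, (i < r)%N -> (j <= s)%N -> pv e i j = pv e' i j
    & forall i j, (i <= r)%N -> (j < s)%N -> ph e i j = ph e' i j].

Definition measurable_edges d (Om : measurableType d) n (E : Om -> edges n)
    : Prop :=
  [/\ forall m j x, measurable [set w | qv (E w) m j = x],
      forall p j x, measurable [set w | qh (E w) p j = x],
      forall i j x, measurable [set w | pv (E w) i j = x]
    & forall i j x, measurable [set w | ph (E w) i j = x]].

(* The random edge configuration [E] is obtained from its bottom boundary data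
   [M] and [d] by running the queue model and then the quadrant model: on each
   finite region, conditionally on the bottom boundary data, the probability of
   an edge configuration is the product of its vertex weights. *)
Definition vertex_model (R : realType) d (Om : measurableType d)
    (P : probability Om R) n
    (Wqueue : 'I_n -> vconf n -> hconf n -> vconf n -> hconf n -> R)
    (Wqp : color n -> hconf n -> color n -> hconf n -> R)
    (E : Om -> edges n) : Prop :=
  [/\ measurable_edges E,
      forall w, admissible (E w)
    & forall r s (e : edges n), admissible e ->
        P [set w | agree r s (E w) e] =
        (P [set w | agree r 0 (E w) e] *
         (\prod_(j < s)
           (\prod_(m < n)
              Wqueue m (qv e m j) (qh e m.+1 j) (qv e m j.+1) (qh e m j) *
            \prod_(i < r)
              Wqp (pv e i j) (ph e i j) (pv e i j.+1) (ph e i.+1 j)))%:E)%E].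

Definition edgesM n (e : edges n) : vstate n := [ffun m => qv e m 0%N].

(* [boundary I J e] lists the vertical and the horizontal edges entering the
   quadrant Z_{>=I} x Z_{>=J+1}. *)
Definition boundary n (I J : nat) (e : edges n) :
    (nat -> color n) * (nat -> hconf n) :=
  (fun i => pv e (I + i) J, fun j => ph e I (J + j)).

(* Generators of the product sigma-algebra of the discrete ones. *)
Definition coordinate_sets n : set (set ((nat -> color n) * (nat -> hconf n))) :=
  [set S | (exists i c, S = [set x | x.1 i = c]) \/
           (exists j D, S = [set x | x.2 j = D])].

Definition same_law (R : realType) d (Om : measurableType d)
    (P : probability Om R) n
    (X Y : Om -> (nat -> color n) * (nat -> hconf n)) : Prop :=
  forall S, <<s @coordinate_sets n >> S -> P (X @^-1` S) = P (Y @^-1` S).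

(* Main.v *)
(* By the Yang-Baxter equation, applied column by column, a row of line weights
   followed by a queue row and a crossing with a quadrant weight has the same
   law as the queue row followed by the line row.  The bottom data
   (M, d(0), d(-1), ...) is obtained from the law of M by stacking line rows,
   so this exchange pushes one quadrant column, or one quadrant row, through
   the whole stack.  Pushing a column absorbs d(0) and gives the shift to the
   right.  Pushing a row gives the shift upwards, provided that the law of M is
   preserved by one queue row: that law is invariant under line rows, hence so
   is its image under a queue row, and the chain of line rows has only one
   invariant law because it can reach the empty state from every state. *)

From HB Require Import structures.
Require Import Defs.
From mathcomp Require Import finmap all_boot all_order all_algebra.
From mathcomp Require Import all_classical all_reals all_analysis.
From mathcomp Require Import ring lra zify.

Set Implicit Arguments.
Unset Strict Implicit.
Unset Printing Implicit Defensive.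

Import Order.TTheory GRing.Theory Num.Theory.
Import numFieldNormedType.Exports.

Local Open Scope classical_set_scope.
Local Open Scope ring_scope.

(** * Sums of nonnegative extended reals *)

(** With the vertex weights fixed, a quadrant is determined by the joint law of its entering edges.
    A shift by one column or one row is therefore a single identity: summing out that column or row
    must return the same entering law. A column disappears because the line row that emits [d(0)],
    once it has been carried above all queue rows, has free outputs, whose weights sum to 1. The
    cross leaves no trace at the left boundary because conservation of arrows forces the empty
    quadrant vertex to have weight 1. The set of states is infinite, and the steady state is given
    only as a limit of finite rectangles. Mass could escape from the sums over intermediate states,
    so only an inequality passes to the limit; it becomes an equality because both sides have total
    mass 1. Uniqueness of the invariant law is handled in the same spirit: it compares two laws
    pointwise and by mass, without a convergence theorem for the chain. *)

Section NonnegativeExtendedReals.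
Variable R : realType.

(* Restricting to nonnegative values makes distributivity and the exchange of
   infinite sums unconditional. *)
Record nne := NNE { nnval : \bar R; _ : (0 <= nnval)%E }.

HB.instance Definition _ := [isSub for nnval].
HB.instance Definition _ := [Choice of nne by <:].

Lemma nne_ge0 (x : nne) : (0 <= nnval x)%E. Proof. by case: x. Qed.

Definition nne0 : nne := @NNE 0%E (lexx _).
Definition nne1 : nne := @NNE 1%E lee01.
Definition nne_add (x y : nne) : nne :=
  @NNE (nnval x + nnval y)%E (adde_ge0 (nne_ge0 x) (nne_ge0 y)).
Definition nne_mul (x y : nne) : nne :=
  @NNE (nnval x * nnval y)%E (mule_ge0 (nne_ge0 x) (nne_ge0 y)).

Lemma nne_addA : associative nne_add.
Proof. by move=> x y z; apply: val_inj; rewrite /= addeA. Qed.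
Lemma nne_addC : commutative nne_add.
Proof. by move=> x y; apply: val_inj; rewrite /= addeC. Qed.
Lemma nne_add0 : left_id nne0 nne_add.
Proof. by move=> x; apply: val_inj; rewrite /= add0e. Qed.

HB.instance Definition _ := GRing.isNmodule.Build nne nne_addA nne_addC nne_add0.

Lemma nne_mulA : associative nne_mul.
Proof. by move=> x y z; apply: val_inj; rewrite /= muleA. Qed.
Lemma nne_mulC : commutative nne_mul.
Proof. by move=> x y; apply: val_inj; rewrite /= muleC. Qed.
Lemma nne_mul1 : left_id nne1 nne_mul.
Proof. by move=> x; apply: val_inj; rewrite /= mul1e. Qed.
Lemma nne_mulDl : left_distributive nne_mul nne_add.
Proof.
by move=> x y z; apply: val_inj; rewrite /= ge0_muleDl ?nne_ge0.
Qed.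

Lemma nne_mul0 : left_zero nne0 nne_mul.
Proof. by move=> x; apply: val_inj; rewrite /= mul0e. Qed.
Lemma nne_10 : nne1 != nne0.
Proof. by apply/eqP => /(congr1 nnval) /= [] /eqP; rewrite oner_eq0. Qed.

HB.instance Definition _ := GRing.Nmodule_isComNzSemiRing.Build nne
  nne_mulA nne_mulC nne_mul1 nne_mulDl nne_mul0 nne_10.

Lemma nnval0 : nnval 0 = 0%E. Proof. by []. Qed.
Lemma nnvalM (x y : nne) : nnval (x * y) = (nnval x * nnval y)%E.
Proof. by []. Qed.
Lemma nnval_inj : injective nnval. Proof. exact: val_inj. Qed.

(* The absolute value matters only as a junk value at negative [r]. *)
Definition nnr (r : R) : nne := @NNE `|r|%:E (abse_ge0 r%:E).

Lemma nnval_nnr r : 0 <= r -> nnval (nnr r) = r%:E.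
Proof. by move=> r0; rewrite /= ger0_norm. Qed.
Lemma nnr0 : nnr 0 = 0. Proof. by apply: val_inj; rewrite /= normr0. Qed.
Lemma nnr1 : nnr 1 = 1. Proof. by apply: val_inj; rewrite /= normr1. Qed.
Lemma nnrM r s : nnr (r * s) = nnr r * nnr s.
Proof. by apply: val_inj; rewrite /= normrM EFinM. Qed.
Lemma nnr_prod (I : Type) (s : seq I) (Q : pred I) (F : I -> R) :
  nnr (\prod_(i <- s | Q i) F i) = \prod_(i <- s | Q i) nnr (F i).
Proof. exact: (big_morph nnr nnrM nnr1). Qed.
Lemma nnr_bool (b : bool) : nnr b%:R = b%:R.
Proof. by case: b; rewrite ?nnr0 ?nnr1. Qed.
Lemma nnr_eq0 r : (nnr r == 0) = (r == 0).
Proof.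
apply/eqP/eqP => [/(congr1 nnval) /= [] /eqP|->]; last exact: nnr0.
by rewrite normr_eq0 => /eqP.
Qed.

Lemma nnval_eq0 (x : nne) : (nnval x = 0)%E -> x = 0.
Proof. by move=> h; apply: val_inj. Qed.

Definition tsum (T : choiceType) (F : T -> nne) : nne :=
  @NNE (\esum_(x in [set: T]) nnval (F x))
       (esum_ge0 (fun x _ => nne_ge0 (F x))).

Lemma eq_tsum (T : choiceType) (F G : T -> nne) :
  F =1 G -> tsum F = tsum G.
Proof. by move=> FG; congr tsum; apply/funext. Qed.

Lemma tsum_pair (T U : choiceType) (F : T * U -> nne) :
  tsum F = tsum (fun x => tsum (fun y => F (x, y))).
Proof.
apply: val_inj => /=.
rewrite (esum_esum (fun i j _ _ => nne_ge0 (F (i, j)))).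
rewrite (_ : _ `*`` _ = setT); last by apply/seteqP; split.
by apply: eq_esum => -[].
Qed.

Lemma tsum_reindex (T U : choiceType) (f : T -> U) (F : U -> nne) :
  bijective f -> tsum F = tsum (F \o f).
Proof.
move=> bij_f; apply: val_inj => /=; apply: reindex_esum.
by rewrite setTT_bijective.
Qed.

Lemma tsumC (T U : choiceType) (F : T -> U -> nne) :
  tsum (fun x => tsum (F x)) = tsum (fun y => tsum (F ^~ y)).
Proof.
have E (A B : choiceType) (G : A -> B -> nne) :
  tsum (fun x => tsum (G x)) = tsum (fun p : A * B => G p.1 p.2).
  by rewrite tsum_pair.
rewrite !E (@tsum_reindex (U * T)%type _ (fun p => (p.2, p.1)))//.
by exists (fun p => (p.2, p.1)); case.
Qed.

Lemma tsum_le (T : choiceType) (F G : T -> nne) :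
  (forall x, (nnval (F x) <= nnval (G x))%E) ->
  (nnval (tsum F) <= nnval (tsum G))%E.
Proof. by move=> h; apply: le_esum. Qed.

Lemma tsum_ge_term (T : choiceType) (F : T -> nne) x :
  (nnval (F x) <= nnval (tsum F))%E.
Proof.
apply: esum_ge; exists [set x]; first by split => //; exact: finite_set1.
by rewrite fsbig_set1.
Qed.

Lemma tsum0 (T : choiceType) : tsum (fun _ : T => 0) = 0.
Proof. by apply: val_inj; rewrite /= esum1. Qed.

Lemma tsum_eq0 (T : choiceType) (F : T -> nne) :
  tsum F = 0 -> forall x, F x = 0.
Proof.
move=> F0 x; apply: nnval_eq0; apply/eqP; rewrite eq_le nne_ge0 andbT.
by rewrite (le_trans (tsum_ge_term F x))// F0.
Qed.

(** One inequality comes from finite partial sums. For finite nonzero [c] the other one is the same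
    inequality applied to [c^-1] and the scaled family; for infinite [c] a single nonzero term
    already makes the right side infinite. *)
Lemma tsumMr (T : choiceType) c (F : T -> nne) :
  c * tsum F = tsum (fun x => c * F x).
Proof.
have le (d : nne) (G : T -> nne) :
  (nnval (tsum (fun x => (d * G x)%R)) <= nnval (d * tsum G)%R)%E.
  rewrite nnvalM /=; apply: ge_ereal_sup => _ [X [finX _] <-].
  rewrite -ge0_mule_fsumr; last by move=> x; exact: nne_ge0.
  by rewrite lee_wpmul2l ?nne_ge0//; apply: esum_ge; exists X.
apply: nnval_inj; apply/eqP; rewrite eq_le le andbT.
have [->|F0] := eqVneq (tsum F) 0; first by rewrite mulr0 nne_ge0.
have [->|c0] := eqVneq c 0; first by rewrite mul0r nne_ge0.
case: c c0 => -[r||] r0 c0 //; last first.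
  suff [x Fx] : exists x, F x != 0.
    have Fx0 : (0 < nnval (F x))%E.
      rewrite lt_neqAle nne_ge0 andbT eq_sym; apply: contra Fx => /eqP Fx.
      by rewrite (nnval_eq0 Fx).
    apply: le_trans (tsum_ge_term _ x).
    by rewrite [leRHS]nnvalM /= (gt0_mulye Fx0) leey.
  apply: contrapT => nF; move/eqP: F0; apply.
  rewrite -(tsum0 T); apply: eq_tsum => x.
  by apply: contrapT => Fx; apply: nF; exists x; apply/eqP.
have rn0 : r != 0.
  by apply: contra c0 => /eqP r_0; apply/eqP; apply: nnval_eq0; rewrite /= r_0.
have := le (nnr r^-1) (fun x => NNE r0 * F x).
under eq_tsum => x.
  rewrite mulrA (_ : nnr r^-1 * NNE r0 = 1) ?mul1r; last first.
    apply: nnval_inj; rewrite nnvalM nnval_nnr /= ?invr_ge0 -?lee_fin//.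
    by rewrite -EFinM mulVf.
  over.
move=> h; have {h} := lee_wpmul2l r0 h.
rewrite -[r%:E]/(nnval (NNE r0)) -!nnvalM [in X in (_ <= X)%E]mulrA.
rewrite (_ : NNE r0 * nnr r^-1 = 1) ?mul1r//.
apply: nnval_inj; rewrite !nnvalM nnval_nnr /= ?invr_ge0 -?lee_fin//.
by rewrite -EFinM mulfV.
Qed.

Lemma tsumMl (T : choiceType) c (F : T -> nne) :
  tsum F * c = tsum (fun x => F x * c).
Proof. by rewrite mulrC tsumMr; apply: eq_tsum => x; rewrite mulrC. Qed.

Lemma tsumD (T : choiceType) (F G : T -> nne) :
  tsum (fun x => F x + G x) = tsum F + tsum G.
Proof.
by apply: nnval_inj => /=; rewrite -esumD => [|x _|x _]; rewrite ?nne_ge0.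
Qed.

Lemma tsum_supp1 (T : choiceType) a (F : T -> nne) :
  (forall x, x != a -> F x = 0) -> tsum F = F a.
Proof.
move=> Fa; apply: val_inj => /=; rewrite -(@esum_set1 R T a (fun x => nnval (F x))) ?nne_ge0//.
rewrite [RHS]esum_mkcond; apply: eq_esum => x _.
case: ifPn => [//|xa]; rewrite Fa//; apply: contra xa => /eqP ->.
by rewrite inE.
Qed.

Lemma tsum_delta (T : choiceType) a (F : T -> nne) :
  tsum (fun x => (x == a)%:R * F x) = F a.
Proof.
rewrite (@tsum_supp1 _ a) ?eqxx ?mul1r// => x /negPf ->.
by rewrite mul0r.
Qed.

Lemma tsum_option (T : choiceType) (F : option T -> nne) :
  tsum F = F None + tsum (fun x => F (Some x)).
Proof.
have -> : tsum F = tsum (fun x => (x == None)%:R * F x)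
                 + tsum (fun x => (x != None)%:R * F x).
  rewrite -tsumD; apply: eq_tsum => x.
  by case: (x == None); rewrite mul1r mul0r ?addr0 ?add0r.
rewrite tsum_delta; congr (_ + _); apply: nnval_inj => /=.
rewrite -(@esum_image R _ _ [set: T] Some (fun x => nnval (F x))); last first.
  by move=> x y _ _ [].
rewrite [RHS]esum_mkcond; apply: eq_esum => -[x|] _; rewrite ?mul1e.
  by rewrite mem_set//; exists x.
by rewrite mul0e memNset// => -[x].
Qed.

Lemma tsum_fin (T : finType) (F : T -> nne) : tsum F = \sum_x F x.
Proof.
apply: nnval_inj => /=; rewrite (big_morph nnval (fun _ _ => erefl) nnval0).
rewrite (_ : [set: T] = [set` enum T]); last first.
  by apply/seteqP; split => x //= _; rewrite mem_enum.
have fin_enum : finite_set [set` enum T] by exact: finite_seq.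
rewrite esum_fset//; last by move=> x _; exact: nne_ge0.
by rewrite -fsbig_seq ?enum_uniq// big_enum.
Qed.

Definition ffcons (T : Type) p (a : T) (f : {ffun 'I_p -> T}) :
    {ffun 'I_p.+1 -> T} :=
  [ffun i => if unlift ord0 i is Some j then f j else a].

Lemma ffcons0 (T : Type) p (a : T) (f : {ffun 'I_p -> T}) :
  ffcons a f ord0 = a.
Proof. by rewrite ffunE unlift_none. Qed.

Lemma ffconsS (T : Type) p (a : T) (f : {ffun 'I_p -> T}) i :
  ffcons a f (lift ord0 i) = f i.
Proof. by rewrite ffunE liftK. Qed.

Definition fftail (T : Type) p (f : {ffun 'I_p.+1 -> T}) : {ffun 'I_p -> T} :=
  [ffun i => f (lift ord0 i)].

Lemma fftailE (T : Type) p (f : {ffun 'I_p.+1 -> T}) i :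
  fftail f i = f (lift ord0 i).
Proof. by rewrite ffunE. Qed.

Lemma ffconsK (T : Type) p (f : {ffun 'I_p.+1 -> T}) :
  ffcons (f ord0) (fftail f) = f.
Proof.
by apply/ffunP => i; rewrite ffunE; case: unliftP => [j ->|->]; rewrite ?ffunE.
Qed.

Lemma fftailK (T : Type) p (a : T) (f : {ffun 'I_p -> T}) :
  fftail (ffcons a f) = f.
Proof. by apply/ffunP => i; rewrite !ffunE liftK. Qed.

Lemma tsum_ffun0 (T : choiceType) (F : {ffun 'I_0 -> T} -> nne) f :
  tsum F = F f.
Proof.
apply: tsum_supp1 => g /eqP[]; apply/ffunP => -[i lti].
by exfalso; move: lti; rewrite ltn0.
Qed.

Lemma tsum_ffunS (T : choiceType) p (F : {ffun 'I_p.+1 -> T} -> nne) :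
  tsum F = tsum (fun a => tsum (fun f : {ffun 'I_p -> T} => F (ffcons a f))).
Proof.
rewrite (@tsum_reindex (T * {ffun 'I_p -> T})%type _
  (fun x => ffcons x.1 x.2)) ?tsum_pair//.
exists (fun f : {ffun 'I_p.+1 -> T} => (f ord0, fftail f)) => [[a f]|f] /=.
  by rewrite ffcons0 fftailK.
exact: ffconsK.
Qed.

Lemma tsum_tuple0 (T : choiceType) (F : 0.-tuple T -> nne) :
  tsum F = F [tuple].
Proof. by apply: tsum_supp1 => t; rewrite tuple0 eqxx. Qed.

Lemma tsum_tupleS (T : choiceType) p (F : p.+1.-tuple T -> nne) :
  tsum F = tsum (fun a => tsum (fun t : p.-tuple T => F [tuple of a :: t])).
Proof.
rewrite (@tsum_reindex (T * p.-tuple T)%type _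
  (fun x => [tuple of x.1 :: x.2])) ?tsum_pair//.
exists (fun t => (thead t, [tuple of behead t])) => [[a t]|t] /=.
  by congr (_, _); apply: val_inj.
by rewrite [RHS]tuple_eta; apply: val_inj.
Qed.

(** All terms but the one at [x] can be cancelled because the total is finite. This is the mass
    argument behind both the uniqueness of the invariant law and the passage to the steady state. *)
Lemma tsum_le_eq (T : choiceType) (F G : T -> nne) :
  (forall x, (nnval (F x) <= nnval (G x))%E) -> tsum F = tsum G ->
  (nnval (tsum G) < +oo)%E -> F =1 G.
Proof.
move=> FG eqFG Gfin x.
have split_at (H : T -> nne) :
    tsum H = H x + tsum (fun y => (y != x)%:R * H y).
  rewrite -(tsum_delta x H) -tsumD; apply: eq_tsum => y.
  by case: (y == x); rewrite mul1r mul0r ?addr0 ?add0r.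
move: eqFG Gfin; rewrite (split_at F) (split_at G).
set f := tsum _; set g := tsum _ => eqFG Gfin.
have fg : (nnval f <= nnval g)%E.
  by apply: tsum_le => y; case: (y != x); rewrite ?mul1r ?mul0r.
apply: nnval_inj; apply/eqP; rewrite eq_le FG/=.
move/(congr1 nnval) : eqFG; move: fg Gfin (FG x); clearbody f g.
case: f g (F x) (G x) => [[f||] f0] [[g||] g0] [[Fx||] Fx0] [[Gx||] Gx0] //=.
by rewrite !lee_fin => fg _ _ [] FG_eq; lra.
Qed.

End NonnegativeExtendedReals.

Arguments nnval {R} _%_R.

(** * Rows of vertices and the Yang-Baxter exchange *)

Notation "\tsum_ x F" := (tsum (fun x => F))
  (at level 41, x name, F at level 41, right associativity,
   format "'[' \tsum_ x '/  '  F ']'") : ring_scope.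

Section Rows.
Variable R : realType.

Lemma tsum3C (A B C D : choiceType) (F : A -> B -> C -> D -> nne R) :
  \tsum_a \tsum_b \tsum_c \tsum_d F a b c d =
  \tsum_d \tsum_a \tsum_b \tsum_c F a b c d.
Proof.
rewrite [RHS]tsumC; apply: eq_tsum => a.
rewrite [RHS]tsumC; apply: eq_tsum => b.
by rewrite [RHS]tsumC.
Qed.

Lemma tsumMr3 (A B C : choiceType) c (F : A -> B -> C -> nne R) :
  c * (\tsum_x \tsum_y \tsum_z F x y z) = \tsum_x \tsum_y \tsum_z (c * F x y z).
Proof.
rewrite tsumMr; apply: eq_tsum => x; rewrite tsumMr; apply: eq_tsum => y.
by rewrite tsumMr.
Qed.

Lemma tsum_mul2 (A B : choiceType) c (F : A -> nne R) (G : B -> nne R) :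
  tsum F * tsum G * c = \tsum_x \tsum_y (F x * G y * c).
Proof.
rewrite !tsumMl; apply: eq_tsum => x; rewrite tsumMr tsumMl.
by apply: eq_tsum.
Qed.

Section Rowsum.
Variables (A H : choiceType).

(** Partition function of one row with its two outer edges fixed. As in [line_edges], horizontal
    edges are numbered from the right: [h ord_max] enters the row and [h ord0] leaves it. *)
Definition rowsum p (w : 'I_p -> A -> H -> A -> H -> nne R)
    (M : {ffun 'I_p -> A}) (a : H) (N : {ffun 'I_p -> A}) (b : H) : nne R :=
  tsum (fun h : {ffun 'I_p.+1 -> H} => (h ord_max == a)%:R * (h ord0 == b)%:R *
    \prod_(m < p) w m (M m) (h (lift ord0 m)) (N m) (h (widen_ord (leqnSn p) m))).

Lemma rowsum0 w (M : {ffun 'I_0 -> A}) a N b :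
  rowsum w M a N b = (a == b)%:R.
Proof.
rewrite /rowsum tsum_ffunS -(tsum_delta a (fun x => (x == b)%:R)).
apply: eq_tsum => x; rewrite (@tsum_ffun0 _ _ _ [ffun=> x]) big_ord0 mulr1.
by rewrite (_ : ord_max = ord0) ?ffcons0//; apply: val_inj.
Qed.

(** Column [ord0] is the rightmost one, hence the last vertex met in the row; the edge [u] is the
    exit of all the columns to its left. *)
Lemma rowsumS p (w : 'I_p.+1 -> A -> H -> A -> H -> nne R) M a N b :
  rowsum w M a N b =
  \tsum_u (rowsum (fun m => w (lift ord0 m)) (fftail M) a (fftail N) u *
           w ord0 (M ord0) u (N ord0) b).
Proof.
under [RHS]eq_tsum => u do rewrite /rowsum tsumMl.
rewrite [RHS]tsumC /rowsum tsum_ffunS tsumC; apply: eq_tsum => g.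
rewrite (@tsum_supp1 _ _ b) => [|c /negPf cb]; last first.
  by rewrite ffcons0 cb mulr0 mul0r.
rewrite (@tsum_supp1 _ _ (g ord0)) => [|u]; last first.
  by rewrite eq_sym => /negPf ->; rewrite mulr0 !mul0r.
rewrite big_ord_recl ffcons0 !eqxx.
have -> : ord_max = lift ord0 (@ord_max p) by exact: val_inj.
rewrite !ffconsS (_ : widen_ord _ ord0 = ord0); last exact: val_inj.
rewrite ffcons0 !mulr1 -!mulrA; congr (_ * _); rewrite mulrC; congr (_ * _).
apply: eq_bigr => m _; rewrite !fftailE ffconsS.
by rewrite (_ : widen_ord _ (lift ord0 m) = lift ord0 (widen_ord (leqnSn p) m))
  ?ffconsS//; apply: val_inj.
Qed.

Lemma rowsum_stoch p (w : 'I_p -> A -> H -> A -> H -> nne R)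
    (M : {ffun 'I_p -> A}) a :
  (forall m k, \tsum_c \tsum_l w m (M m) k c l = 1) ->
  \tsum_N \tsum_b rowsum w M a N b = 1.
Proof.
elim: p => [|p IH] in w M * => w1.
  rewrite (@tsum_ffun0 _ _ _ M).
  under eq_tsum => b do rewrite rowsum0 eq_sym -[_%:R]mulr1.
  exact: tsum_delta.
rewrite tsum_ffunS tsumC.
rewrite -(IH (fun m => w (lift ord0 m)) (fftail M)); last first.
  by move=> m k; rewrite fftailE w1.
apply: eq_tsum => N.
under eq_tsum => c.
  under eq_tsum => b do rewrite rowsumS fftailK ffcons0.
  rewrite tsumC.
  over.
rewrite tsumC; apply: eq_tsum => u.
under eq_tsum => c do rewrite -tsumMr.
by rewrite -tsumMr w1 mulr1.
Qed.

Lemma le_rowsum p (w : 'I_p -> A -> H -> A -> H -> nne R)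
    (M N : {ffun 'I_p -> A}) a b
    (h : {ffun 'I_p.+1 -> H}) :
  h ord_max = a -> h ord0 = b ->
  (nnval (\prod_(m < p) w m (M m) (h (lift ord0 m)) (N m)
            (h (widen_ord (leqnSn p) m))) <= nnval (rowsum w M a N b))%E.
Proof.
move=> ha hb; apply: le_trans (tsum_ge_term _ h).
by rewrite ha hb !eqxx !mul1r.
Qed.

(** Extracts from a possible transition a horizontal path of nonzero vertex weights, along which
    conservation of arrows can be followed. *)
Lemma rowsum_eq0 p (w : 'I_p -> A -> H -> A -> H -> nne R)
    (M N : {ffun 'I_p -> A}) a b :
  rowsum w M a N b <> 0 -> exists h : {ffun 'I_p.+1 -> H},
   [/\ h ord_max = a, h ord0 = b & forall m,
     w m (M m) (h (lift ord0 m)) (N m) (h (widen_ord (leqnSn p) m)) != 0].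
Proof.
move=> r0; apply: contrapT => nh; apply: r0.
rewrite /rowsum -[RHS](@tsum0 R {ffun 'I_p.+1 -> H}); apply: eq_tsum => h.
have [ha|_] := eqVneq (h ord_max) a; last by rewrite !mul0r.
have [hb|_] := eqVneq (h ord0) b; last by rewrite mulr0 mul0r.
have [/forallP hw|] := boolP [forall m : 'I_p,
    w m (M m) (h (lift ord0 m)) (N m) (h (widen_ord (leqnSn p) m)) != 0].
  by exfalso; apply: nh; exists h.
rewrite negb_forall => /existsP[m]; rewrite negbK => /eqP wm.
by rewrite (bigD1 m)//= wm mul0r mulr0.
Qed.

End Rowsum.

Section Train.
Variables (H1 H2 : choiceType) (X : H1 -> H2 -> H1 -> H2 -> nne R).

(** The Yang-Baxter equation with [X] as the crossing of the two horizontal lines: it stands to the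
    right of the column on the left side, and to the left of the column on the right side, where the
    order of the two lines is reversed. *)
Definition intertwined (A : choiceType) (w1 : A -> H1 -> A -> H1 -> nne R)
    (w2 : A -> H2 -> A -> H2 -> nne R) :=
  forall a b i I j J,
    \tsum_c \tsum_k \tsum_K (w1 a i c k * w2 c I b K * X k K j J) =
    \tsum_c \tsum_k \tsum_K (X i I k K * w2 a K c J * w1 c k b j).

(* Moving the cross weight through a row one column at a time. *)
Lemma intertwined_rowsum (A : choiceType) p
    (w1 : 'I_p -> A -> H1 -> A -> H1 -> nne R)
    (w2 : 'I_p -> A -> H2 -> A -> H2 -> nne R) :
  (forall m, intertwined (w1 m) (w2 m)) ->
  intertwined (rowsum w1) (rowsum w2).
Proof.
elim: p => [|p IH] in w1 w2 * => w12 a b i I j J.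
  rewrite !(@tsum_ffun0 _ _ _ a).
  transitivity (X i I j J).
    rewrite (@tsum_supp1 _ _ i) => [|k /negPf ki]; last first.
      rewrite -(tsum0 R H2); apply: eq_tsum => K.
      by rewrite !rowsum0 eq_sym ki !mul0r.
    rewrite (@tsum_supp1 _ _ I) => [|K /negPf KI]; last first.
      by rewrite !rowsum0 (eq_sym I) KI mulr0 mul0r.
    by rewrite !rowsum0 !eqxx !mul1r.
  rewrite (@tsum_supp1 _ _ j) => [|k /negPf kj]; last first.
    rewrite -(tsum0 R H2); apply: eq_tsum => K.
    by rewrite !rowsum0 kj mulr0.
  rewrite (@tsum_supp1 _ _ J) => [|K /negPf KJ]; last first.
    by rewrite !rowsum0 KJ mulr0 mul0r.
  by rewrite !rowsum0 !eqxx !mulr1.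
set r1 := rowsum (fun m => w1 (lift ord0 m)).
set r2 := rowsum (fun m => w2 (lift ord0 m)).
have IHa := IH _ _ (fun m => w12 (lift ord0 m)).
transitivity (\tsum_C \tsum_u \tsum_U \tsum_c \tsum_k \tsum_K
  (r1 (fftail a) i C u * r2 C I (fftail b) U *
   (w1 ord0 (a ord0) u c k * w2 ord0 c U (b ord0) K * X k K j J))).
  rewrite tsum_ffunS tsumC; apply: eq_tsum => C.
  under eq_tsum => c do under eq_tsum => k do under eq_tsum => K do
    rewrite !rowsumS fftailK ffcons0 tsum_mul2.
  rewrite tsum3C; apply: eq_tsum => u.
  rewrite tsum3C; apply: eq_tsum => U.
  apply: eq_tsum => c; apply: eq_tsum => k; apply: eq_tsum => K.
  rewrite -/r1 -/r2; ring.
(* The relation of column [ord0] moves the cross between this column and the others. *)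
transitivity (\tsum_C \tsum_u \tsum_U \tsum_c \tsum_k \tsum_K
  (w2 ord0 (a ord0) K c J * w1 ord0 c k (b ord0) j *
   (r1 (fftail a) i C u * r2 C I (fftail b) U * X u U k K))).
  apply: eq_tsum => C; apply: eq_tsum => u; apply: eq_tsum => U.
  rewrite -tsumMr3 w12 tsumMr3.
  apply: eq_tsum => c; apply: eq_tsum => k; apply: eq_tsum => K; ring.
(* The induction hypothesis moves it through all the other columns. *)
transitivity (\tsum_c \tsum_k \tsum_K \tsum_C \tsum_u \tsum_U
  (w2 ord0 (a ord0) K c J * w1 ord0 c k (b ord0) j *
   (X i I u U * r2 (fftail a) U C K * r1 C u (fftail b) k))).
  under eq_tsum => C do under eq_tsum => u do rewrite -tsum3C.
  under eq_tsum => C do rewrite -tsum3C.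
  rewrite -tsum3C.
  apply: eq_tsum => c; apply: eq_tsum => k; apply: eq_tsum => K.
  rewrite -tsumMr3 IHa tsumMr3.
  by apply: eq_tsum => C; apply: eq_tsum => u; apply: eq_tsum => U.
rewrite [RHS]tsum_ffunS; apply: eq_tsum => c; symmetry.
under eq_tsum => C do under eq_tsum => u do under eq_tsum => U do
  rewrite !rowsumS fftailK ffcons0 -mulrA mulrC (mulrC (tsum _)) tsum_mul2.
rewrite tsum3C; apply: eq_tsum => k.
rewrite tsum3C; apply: eq_tsum => K.
apply: eq_tsum => C; apply: eq_tsum => u; apply: eq_tsum => U.
rewrite -/r1 -/r2; ring.
Qed.

End Train.
End Rows.

(** * Pushing a queue row or a line row through a stack *)

Definition scons (T : Type) (x : T) (f : nat -> T) (i : nat) : T :=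
  if i is j.+1 then f j else x.

Section AbstractBurke.
Variables (R : realType) (S C H : choiceType) (x0 : C * H).
Variables (L : S -> S -> C -> nne R) (Q : S -> S -> H -> nne R).
Variable X : C -> H -> C -> H -> nne R.

(** Both rows have empty left inputs, so that a cross appears on one side only. *)
Hypothesis LQX : forall M N j J,
  \tsum_M1 \tsum_k \tsum_V (L M M1 k * Q M1 N V * X k V j J) =
  \tsum_M1 (Q M M1 J * L M1 N j).

Fixpoint queue_out s (D : nat -> H) (M : S) : nne R :=
  if s is s'.+1 then
    \tsum_N (Q M N (D 0%N) * queue_out s' (fun j => D j.+1) N)
  else 1.

(** The stack is read from the top: [d 0] leaves the last row that is run, and [f] is the law of the
    state below all [r] rows. *)
Fixpoint line_law r (d : nat -> C) (f : S -> nne R) (M : S) : nne R :=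
  if r is r'.+1 then
    \tsum_N (line_law r' (fun i => d i.+1) f N * L N M (d 0%N))
  else f M.

Definition queue_step (f : S -> nne R) (N : S) : nne R :=
  \tsum_M \tsum_V (f M * Q M N V).

Definition colors r (t : r.-tuple (C * H)) (i : nat) : C := (nth x0 t i).1.
Definition hconfs r (t : r.-tuple (C * H)) (i : nat) : H := (nth x0 t i).2.

Lemma colors_cons r a (t : r.-tuple (C * H)) :
  colors [tuple of a :: t] = scons a.1 (colors t).
Proof. by apply/funext => -[]. Qed.
Lemma hconfs_cons r a (t : r.-tuple (C * H)) :
  hconfs [tuple of a :: t] = scons a.2 (hconfs t).
Proof. by apply/funext => -[]. Qed.

Definition row_weight r (d : nat -> C) (V : nat -> H) (c : nat -> C) : nne R :=
  \prod_(i < r) X (d i) (V i) (c i) (V i.+1).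

Definition column_weight s (k : nat -> C) (V D : nat -> H) : nne R :=
  \prod_(j < s) X (k j) (V j) (k j.+1) (D j).

(** The queue row starts above [r] line rows. Each exchange with the line row just below it uses up
    one vertex of the quadrant row, which replaces the color emitted by that line row; at the end
    the queue row acts directly on [f]. *)
Lemma row_law r (c : nat -> C) f N :
  \tsum_V0 tsum (fun t : r.-tuple (C * H) =>
    (\tsum_M (line_law r (colors t) f M * Q M N V0)) *
      row_weight r (colors t) (scons V0 (hconfs t)) c) =
  line_law r c (queue_step f) N.
Proof.
elim: r => [|r IH] in c N *.
  under eq_tsum => V0 do rewrite tsum_tuple0 /row_weight big_ord0 mulr1.
  by rewrite tsumC.
pose G M M1 d0 V1 V0 (t : r.-tuple (C * H)) :=
  line_law r (colors t) f M1 *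
    row_weight r (colors t) (scons V1 (hconfs t)) (fun i => c i.+1) *
  (L M1 M d0 * Q M N V0 * X d0 V0 (c 0%N) V1).
(* [M], [d0] and [V0] are moved innermost, since these are the variables summed on the left side of
   [LQX]. *)
transitivity (\tsum_M1 \tsum_V1 \tsum_t \tsum_M \tsum_d0 \tsum_V0
    G M M1 d0 V1 V0 t).
  transitivity (\tsum_V0 \tsum_d0 \tsum_V1 \tsum_t \tsum_M \tsum_M1
      G M M1 d0 V1 V0 t).
    apply: eq_tsum => V0; rewrite tsum_tupleS tsum_pair.
    apply: eq_tsum => d0; apply: eq_tsum => V1; apply: eq_tsum => t.
    rewrite tsumMl; apply: eq_tsum => M.
    rewrite colors_cons hconfs_cons /= !tsumMl; apply: eq_tsum => M1.
    rewrite /row_weight big_ord_recl /= /G /row_weight.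
    by ring.
  under eq_tsum => V0 do under eq_tsum => d0 do under eq_tsum => V1 do
    under eq_tsum => t do rewrite tsumC.
  under eq_tsum => V0 do under eq_tsum => d0 do under eq_tsum => V1 do
    rewrite tsumC.
  under eq_tsum => V0 do under eq_tsum => d0 do rewrite tsumC.
  under eq_tsum => V0 do rewrite tsumC.
  rewrite tsumC; apply: eq_tsum => M1.
  under eq_tsum => V0 do rewrite tsumC.
  rewrite tsumC; apply: eq_tsum => V1.
  under eq_tsum => V0 do rewrite tsumC.
  rewrite tsumC; apply: eq_tsum => t.
  under eq_tsum => V0 do rewrite tsumC.
  rewrite tsumC; apply: eq_tsum => M.
  by rewrite tsumC.
transitivity (\tsum_M1 \tsum_V1 tsum (fun t : r.-tuple (C * H) => \tsum_M2
    (line_law r (colors t) f M1 *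
     row_weight r (colors t) (scons V1 (hconfs t)) (fun i => c i.+1) *
     (Q M1 M2 V1 * L M2 N (c 0%N))))).
  apply: eq_tsum => M1; apply: eq_tsum => V1; apply: eq_tsum => t.
  by rewrite /G -tsumMr3 LQX tsumMr.
under eq_tsum => M1 do under eq_tsum => V1 do rewrite tsumC.
under eq_tsum => M1 do rewrite tsumC.
rewrite tsumC /=; apply: eq_tsum => M2.
rewrite -IH tsumC tsumMl; apply: eq_tsum => V1.
rewrite tsumC tsumMl; apply: eq_tsum => t.
rewrite !tsumMl; apply: eq_tsum => M1; ring.
Qed.

(** The topmost line row climbs through the [s] queue rows. Each exchange uses up one vertex of the
    quadrant column and replaces one queue output by [D j]. Above all queue rows its outputs are
    unconstrained and sum to 1; [ok] collects the states from which this sum is known. *)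
Lemma column_law (ok : pred S) r s d f D :
  (forall M, ok M -> \tsum_N \tsum_k L M N k = 1) ->
  (forall M N k, L M N k != 0 -> ok N) ->
  (forall M N V, Q M N V != 0 -> ok N) ->
  (forall M, f M != 0 -> ok M) ->
  \tsum_k0 tsum (fun t : s.-tuple (C * H) =>
    (\tsum_M (line_law r.+1 (scons k0 d) f M * queue_out s (hconfs t) M)) *
     column_weight s (scons k0 (colors t)) (hconfs t) D) =
  \tsum_M (line_law r d f M * queue_out s D M).
Proof.
move=> L1 Lok Qok fok.
have law_ok M : line_law r d f M != 0 -> ok M.
  case: r => [|r] /=; first exact: fok.
  apply: contraNT => nM; rewrite -(tsum0 R S); apply/eqP/eq_tsum => N.
  have [->|/Lok] := eqVneq (L N M (d 0%N)) 0; first by rewrite mulr0.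
  by rewrite (negPf nM).
have main M : ok M -> \tsum_M1 \tsum_k0 tsum (fun t : s.-tuple (C * H) =>
    L M M1 k0 * (queue_out s (hconfs t) M1 *
     column_weight s (scons k0 (colors t)) (hconfs t) D)) = queue_out s D M.
  elim: s D M => [|s IH] D M okM /=.
    rewrite -[RHS](L1 M okM); apply: eq_tsum => M1; apply: eq_tsum => k0.
    by rewrite tsum_tuple0 /column_weight big_ord0 !mulr1.
  pose G M1 k0 k1 V0 (t : s.-tuple (C * H)) N :=
    queue_out s (hconfs t) N *
     column_weight s (scons k1 (colors t)) (hconfs t) (fun j => D j.+1) *
    (L M M1 k0 * Q M1 N V0 * X k0 V0 k1 (D 0%N)).
  transitivity (\tsum_N \tsum_k1 \tsum_t \tsum_M1 \tsum_k0 \tsum_V0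
      G M1 k0 k1 V0 t N).
    transitivity (\tsum_M1 \tsum_k0 \tsum_k1 \tsum_V0 \tsum_t \tsum_N
        G M1 k0 k1 V0 t N).
      apply: eq_tsum => M1; apply: eq_tsum => k0; rewrite tsum_tupleS tsum_pair.
      apply: eq_tsum => k1; apply: eq_tsum => V0; apply: eq_tsum => t.
      rewrite colors_cons hconfs_cons /= tsumMl tsumMr; apply: eq_tsum => N.
      rewrite /column_weight big_ord_recl /= /G /column_weight.
      by ring.
    under eq_tsum => M1 do under eq_tsum => k0 do under eq_tsum => k1 do
      under eq_tsum => V0 do rewrite tsumC.
    under eq_tsum => M1 do under eq_tsum => k0 do under eq_tsum => k1 do
      rewrite tsumC.
    under eq_tsum => M1 do under eq_tsum => k0 do rewrite tsumC.
    under eq_tsum => M1 do rewrite tsumC.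
    rewrite tsumC; apply: eq_tsum => N.
    under eq_tsum => M1 do rewrite tsumC.
    rewrite tsumC; apply: eq_tsum => k1.
    by rewrite tsum3C.
  under eq_tsum => N.
    under eq_tsum => k1.
      under eq_tsum => t.
        rewrite /G -tsumMr3 LQX tsumMr.
        over.
      over.
    over.
  rewrite /=.
  transitivity (\tsum_N \tsum_k1 \tsum_M1 tsum (fun t : s.-tuple (C * H) =>
     Q M M1 (D 0%N) * (L M1 N k1 * (queue_out s (hconfs t) N *
     column_weight s (scons k1 (colors t)) (hconfs t) (fun j => D j.+1))))).
    apply: eq_tsum => N; apply: eq_tsum => k1; rewrite tsumC.
    by apply: eq_tsum => M1; apply: eq_tsum => t; ring.
  under eq_tsum => N do rewrite tsumC.
  rewrite tsumC; apply: eq_tsum => M1.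
  have [->|/Qok okM1] := eqVneq (Q M M1 (D 0%N)) 0.
    rewrite mul0r -[RHS](tsum0 R S); apply: eq_tsum => N.
    rewrite -[RHS](tsum0 R C); apply: eq_tsum => k1.
    rewrite -[RHS](tsum0 R (s.-tuple (C * H)%type)); apply: eq_tsum => t.
    by rewrite mul0r.
  by rewrite -tsumMr3 IH.
transitivity (\tsum_M (line_law r d f M *
  (\tsum_M1 \tsum_k0 tsum (fun t : s.-tuple (C * H) =>
    L M M1 k0 * (queue_out s (hconfs t) M1 *
     column_weight s (scons k0 (colors t)) (hconfs t) D))))); last first.
  apply: eq_tsum => M; have [->|/law_ok okM] := eqVneq (line_law r d f M) 0.
    by rewrite !mul0r.
  by rewrite main.
under [RHS]eq_tsum => M do rewrite tsumMr3.
rewrite [RHS]tsumC.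
under [RHS]eq_tsum => M1 do rewrite tsumC.
rewrite [RHS]tsumC; apply: eq_tsum => k0.
under [RHS]eq_tsum => M1 do rewrite tsumC.
rewrite [RHS]tsumC; apply: eq_tsum => t.
rewrite tsumMl; apply: eq_tsum => M1 /=; rewrite !tsumMl.
by apply: eq_tsum => M; ring.
Qed.

End AbstractBurke.

(** * Uniqueness of stationary laws *)

Lemma nne_mulIf (R : realType) (a b k : nne R) :
  k != 0 -> (nnval k < +oo)%E -> a * k = b * k -> a = b.
Proof.
move=> k0 koo /(congr1 nnval); rewrite !nnvalM => ab; apply: nnval_inj.
have kfin : nnval k \is a fin_num by rewrite ge0_fin_numE ?nne_ge0.
have kfine : fine (nnval k) != 0.
  by rewrite fine_eq0//; apply: contra k0 => /eqP /nnval_eq0 ->.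
have h (x : nne R) : nnval x = (nnval x * nnval k * ((fine (nnval k))^-1)%:E)%E.
  by rewrite -{1}(fineK kfin) -muleA -EFinM mulfV// mule1.
by rewrite (h a) ab -h.
Qed.

Section Uniqueness.
Variables (R : realType) (S : choiceType) (K : S -> S -> nne R).
Variables (good : pred S) (ht : S -> nat) (e : S).
Hypothesis K1 : forall x, good x -> \tsum_y K x y = 1.
Hypothesis descent : forall x, good x -> x != e ->
  exists y, [/\ good y, K x y != 0 & (ht y < ht x)%N].

(* The pointwise minimum of the two laws is again invariant.  It equals one of
   them at [e], hence, following descents, everywhere. *)
Lemma stationary_unique (f g : S -> nne R) :
  (forall x, f x != 0 -> good x) -> (forall x, g x != 0 -> good x) ->
  tsum f = 1 -> tsum g = 1 ->
  (forall y, \tsum_x (f x * K x y) = f y) ->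
  (forall y, \tsum_x (g x * K x y) = g y) -> f =1 g.
Proof.
wlog fge : f g / (nnval (f e) <= nnval (g e))%E => [hw|].
  move=> fs gs f1 g1 fK gK.
  have [fg|/ltW gf] := leP (nnval (f e)) (nnval (g e)); first exact: hw.
  by move=> x; apply/esym/(hw g f).
move=> fs gs f1 g1 fK gK.
pose m x := if (nnval (f x) <= nnval (g x))%E then f x else g x.
have mf x : (nnval (m x) <= nnval (f x))%E.
  by rewrite /m; case: (leP (nnval (f x)) (nnval (g x))) => [_|/ltW]; rewrite ?lexx.
have mg x : (nnval (m x) <= nnval (g x))%E.
  by rewrite /m; case: (leP (nnval (f x)) (nnval (g x))) => [|_]; rewrite ?lexx.
have ms x : m x != 0 -> good x by rewrite /m; case: ifP => _; [exact: fs|exact: gs].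
have leM (a b c : nne R) : (nnval a <= nnval b)%E -> (nnval (a * c) <= nnval (b * c))%E.
  by move=> ab; rewrite !nnvalM lee_wpmul2r ?nne_ge0.
have K_lty x y : good x -> (nnval (K x y) < +oo)%E.
  move=> gx; apply: le_lt_trans (tsum_ge_term (K x) y) _.
  by rewrite (K1 gx) ltry.
(* The image of [m] is below those of [f] and [g], that is, below [f] and [g], hence below [m]; it
   has the same mass as [m], so it equals [m]. *)
have mK : (fun y => \tsum_x (m x * K x y)) =1 m.
  apply: tsum_le_eq.
  - move=> y; have : (nnval (\tsum_x (m x * K x y))%R <= nnval (f y))%E.
      by rewrite -fK; apply: tsum_le => x; exact: leM.
    have : (nnval (\tsum_x (m x * K x y))%R <= nnval (g y))%E.
      by rewrite -gK; apply: tsum_le => x; exact: leM.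
    by rewrite [in X in _ -> _ -> X]/m; case: ifP.
  - rewrite tsumC; apply: eq_tsum => x; rewrite -tsumMr.
    have [->|/ms gx] := eqVneq (m x) 0; first by rewrite mul0r.
    by rewrite K1// mulr1.
  - by apply: le_lt_trans (tsum_le mf) _; rewrite f1 ltry.
have mf_eq x : m x = f x.
  have [gx|] := boolP (good x); last first.
    move=> ngx; have -> : f x = 0 by apply/eqP; apply: contraNT ngx; exact: fs.
    by apply/eqP; apply: contraNT ngx; exact: ms.
  (* Equality at [y] is carried back to [x]: the sums that give [m y] and [f y] are ordered term by
     term and equal, so the terms at [x] agree and [K x y] cancels. *)
  elim: {x}(ht x).+1 {-2}x (ltnSn (ht x)) gx => // h IH x hx gx.
  have [->|xe] := eqVneq x e; first by rewrite /m fge.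
  have [y [gy Kxy hy]] := descent gx xe.
  have my := IH y (leq_trans hy hx) gy.
  apply: (@nne_mulIf _ _ _ (K x y)) => //; first exact: K_lty.
  apply: (@tsum_le_eq _ _ (fun z => m z * K z y) (fun z => f z * K z y)).
  - by move=> z; exact: leM.
  - by rewrite mK fK.
  - rewrite fK; apply: le_lt_trans (tsum_ge_term f y) _.
    by rewrite f1 ltry.
(* Now [f] is below [g], and both have mass 1. *)
apply: tsum_le_eq => [x||]; first by rewrite -mf_eq mg.
  by rewrite f1 g1.
by rewrite g1 ltry.
Qed.

End Uniqueness.

(** * Line weights *)

Section LineWeights.
Variables (R : realType) (n : nat) (q alpha nu : R) (m : 'I_n).
Hypothesis hq : 0 <= q < 1.
Hypothesis alpha0 : 0 < alpha.
Hypothesis hnu : 0 <= nu <= alpha.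

Lemma expq_ge0 k : 0 <= q ^+ k. Proof. by rewrite exprn_ge0//; case/andP: hq. Qed.
Lemma expq_le1 k : q ^+ k <= 1.
Proof. by case/andP: hq => q0 /ltW q1; rewrite exprn_ile1. Qed.

Lemma line_coef_ge0 (A : vconf n) k l : 0 <= line_coef q alpha nu m A k l.
Proof.
have [nu0 nua] := andP hnu; have a0 := ltW alpha0.
have q1 i : 0 <= 1 - q ^+ i by rewrite subr_ge0 expq_le1.
case: l => [l|] /=; last exact: ler01.
case: ifP => // _; set k' := (if k is Some _ then _ else _).
case: k' => [k'|]; repeat case: ifP => _; rewrite ?mulr_ge0 ?expq_ge0//.
rewrite subr_ge0 (le_trans _ nua)// -[leRHS]mulr1 ler_wpM2l ?expq_le1//.
Qed.

Definition vtail_from (A : vconf n) (j : nat) : nat :=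
  (\sum_(i < n | j <= i) vcount A i)%N.

(** Writes the weights as increments of a function of the color, so that their sum over exit colors
    telescopes. *)
Lemma expq_vtail (A : vconf n) l :
  (1 - q ^+ vcount A l) * q ^+ vtail A l =
  q ^+ vtail_from A l.+1 - q ^+ vtail_from A l.
Proof.
rewrite /vtail_from [X in _ = _ - q ^+ X](bigD1 l)//= exprD mulrBl mul1r.
congr (_ - _ * q ^+ _); apply: eq_bigl => i.
by rewrite ltn_neqAle eq_sym andbC.
Qed.

Lemma sum_ord_telescope (T : nat -> R) a b : (a <= b <= n)%N ->
  \sum_(l < n | (a <= l < b)%N) (T l.+1 - T l) = T b - T a.
Proof.
case/andP=> ab bn; rewrite -telescope_sumr// big_geq_mkord /=.
by rewrite (big_ord_widen_cond _ (fun l => (a <= l)%N) (fun l => T l.+1 - T l) bn).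
Qed.

(** The nonzero exit colors contribute [alpha] and the empty exit contributes 1, which explains the
    normalization by [1 + alpha]. *)
Lemma sum_line_coef (A : vconf n) k :
  \sum_(l : 'I_n) line_coef q alpha nu m A k (Some l) = alpha.
Proof.
pose T j := q ^+ vtail_from A j.
have Tn : T n = 1.
  by rewrite /T /vtail_from big1 ?expr0// => i; rewrite leqNgt ltn_ord.
rewrite /line_coef; set k' := (if k is Some _ then _ else _).
have k'm j : k' = Some j -> (m < j)%N.
  by rewrite /k'; case: (k) => // j'; case: ifP => // ? [<-].
clearbody k'; case: k' k'm => [j|] /= k'm.
  have mj := k'm j erefl.
  (* The four terms are the exits [m], between [m] and [j], [j], and above [j]. They telescope to
     [nu * T j], then [alpha * T j.+1 - nu * T j], then [alpha * (1 - T j.+1)], where the first two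
     are taken together. *)
  transitivity (\sum_(l < n) ((if l == m then nu * T m.+1 else 0) +
     (if (m.+1 <= l < j)%N then nu * (T l.+1 - T l) else 0) +
     (if l == j then alpha * T j.+1 - nu * T j else 0) +
     (if (j.+1 <= l < n)%N then alpha * (T l.+1 - T l) else 0))).
    apply: eq_bigr => l _; rewrite -(mulrA alpha) -(mulrA nu) expq_vtail -/(T _) -/(T _).
    rewrite ltn_ord andbT; case: (ltngtP l m) => [lm|lm|/val_inj ->].
    - have /negPf -> : l != m by rewrite neq_ltn lm.
      have lj : (l < j)%N by exact: ltn_trans mj.
      have /negPf -> : l != j by rewrite neq_ltn lj.
      have -> : (j < l)%N = false by rewrite ltnNge (ltnW lj).
      by rewrite !addr0.
    - have /negPf -> : l != m by rewrite neq_ltn lm orbT.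
      have [->|lj] := eqVneq l j.
        rewrite ltnn !add0r addr0 mulrBl /T /vtail_from.
        rewrite [X in _ = _ - _ * q ^+ X](bigD1 j)//= [in RHS]exprD mulrA.
        congr (_ * q ^+ _ - _ * q ^+ _);
        by apply: eq_bigl => i; rewrite ltn_neqAle eq_sym andbC.
      by rewrite [RHS]/=; case: (ltngtP j l) => [jl|jl|/val_inj jl];
        rewrite ?addr0 ?add0r//; move: lj; rewrite jl eqxx.
    - rewrite eqxx; have /negPf -> : m != j by rewrite neq_ltn mj.
      have -> : (j < m)%N = false by rewrite ltnNge (ltnW mj).
      by rewrite !addr0.
  rewrite !big_split /= -!big_mkcond !big_pred1_eq -!mulr_sumr.
  rewrite !sum_ord_telescope ?Tn ?leqnn ?(ltnW (ltn_ord j)) ?mj ?ltn_ord//.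
  by ring.
transitivity (\sum_(l < n) ((if l == m then alpha * T m.+1 else 0) +
   (if (m.+1 <= l < n)%N then alpha * (T l.+1 - T l) else 0))).
  apply: eq_bigr => l _; rewrite -(mulrA alpha) expq_vtail -/(T _) -/(T _).
  rewrite ltn_ord andbT; case: (ltngtP l m) => [lm|lm|/val_inj ->].
  - have /negPf -> : l != m by rewrite neq_ltn lm.
    by rewrite addr0.
  - have /negPf -> : l != m by rewrite neq_ltn lm orbT.
    by rewrite add0r.
  - by rewrite eqxx addr0.
rewrite !big_split /= -!big_mkcond !big_pred1_eq -!mulr_sumr.
rewrite !sum_ord_telescope ?Tn ?leqnn ?ltn_ord//.
by ring.
Qed.

Lemma line_weight_ge0 (A C : vconf n) k l : 0 <= line_weight q alpha nu m A k C l.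
Proof.
rewrite /line_weight; case: ifP => // _.
by rewrite mulr_ge0 ?line_coef_ge0// invr_ge0 addr_ge0 ?ltW.
Qed.

Lemma nnr_sum (I : Type) (s : seq I) (F : I -> R) : (forall i, 0 <= F i) ->
  nnr (\sum_(i <- s) F i) = \sum_(i <- s) nnr (F i).
Proof.
move=> F0; elim: s => [|i s IH]; first by rewrite !big_nil nnr0.
rewrite !big_cons -IH; apply: nnval_inj; rewrite /= !ger0_norm ?addr_ge0//.
all: exact: sumr_ge0.
Qed.

Lemma line_weight_stoch (A : vconf n) k :
  \tsum_C \tsum_l nnr (line_weight q alpha nu m A k C l) = 1.
Proof.
rewrite tsumC.
have a1 : 1 + alpha != 0 by rewrite gt_eqF// addr_gt0.
transitivity (\tsum_l nnr ((1 + alpha)^-1 * line_coef q alpha nu m A k l)).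
  apply: eq_tsum => l.
  rewrite (@tsum_supp1 _ _ (rem_arrow (add_arrow A k) l)) => [|C /negPf C_]; last first.
    by rewrite /line_weight C_ nnr0.
  by rewrite /line_weight eqxx.
have a1i : 0 <= (1 + alpha)^-1 by rewrite invr_ge0 addr_ge0// ltW.
rewrite tsum_option tsum_fin -nnr_sum; last first.
  by move=> l; rewrite mulr_ge0 ?line_coef_ge0.
rewrite -mulr_sumr sum_line_coef /= mulr1.
apply: nnval_inj; rewrite /= !ger0_norm ?mulr_ge0// ?ltW//.
by rewrite -EFinD -{1}(mulr1 _^-1) -mulrDr mulVf.
Qed.

End LineWeights.

(** * Transition kernels of full rows *)

Section Kernels.
Variables (R : realType) (n : nat) (q : R) (alpha nu : 'I_n -> R).
Variable Wqueue : 'I_n -> vconf n -> hconf n -> vconf n -> hconf n -> R.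
Variable Wqp : color n -> hconf n -> color n -> hconf n -> R.
Hypothesis hq : 0 <= q < 1.
Hypothesis halpha0 : forall i, 0 < alpha i.
Hypothesis hnu : forall i, 0 <= nu i <= alpha i.
Hypothesis hqueue : forall m, stochastic_queue_weight m (Wqueue m).
Hypothesis hqp : stochastic_qp_weight Wqp.
Hypothesis hYB : forall m,
  yang_baxter m (line_weight q (alpha m) (nu m) m) (Wqueue m) Wqp.

Definition verticalb (m : 'I_n) (A : vconf n) : bool :=
  [forall i, (A i == None) == (i == m)].

Lemma verticalP m A : reflect (vertical m A) (verticalb m A).
Proof. exact: (iffP 'forall_eqP). Qed.

Lemma mem_vertical (T : Type) (f : T -> vconf n) m x :
  (x \in [set o | vertical m (f o)]) = verticalb m (f x).
Proof. by apply/idP/verticalP; rewrite inE. Qed.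

Lemma verticalb_rem_add m A k l :
  verticalb m (rem_arrow (add_arrow A k) l) = verticalb m A.
Proof.
apply: eq_forallb => i; rewrite /rem_arrow /add_arrow !ffunE.
by case: (l == _); case: (k == _); case: (A i).
Qed.

(* Outside the vertical tuples of column m both weights are set to 0, so that
   all sums range over full types. *)
Definition wline m (A : vconf n) (k : color n) (C : vconf n) (l : color n) : nne R :=
  (verticalb m A && verticalb m C)%:R *
  nnr (line_weight q (alpha m) (nu m) m A k C l).
Definition wqueue m (A : vconf n) (B : hconf n) (C : vconf n) (D : hconf n) : nne R :=
  (verticalb m A && verticalb m C)%:R * nnr (Wqueue m A B C D).
Definition wqp k (B : hconf n) l (D : hconf n) : nne R := nnr (Wqp k B l D).

(** A line vertex sends vertical tuples to vertical tuples, so the restriction on the output removes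
    nothing. *)
Lemma wlineE m A k C l : verticalb m A ->
  wline m A k C l = nnr (line_weight q (alpha m) (nu m) m A k C l).
Proof.
rewrite /wline => vA; rewrite vA /=.
have [vC|vC] := boolP (verticalb m C); first by rewrite mul1r.
rewrite mul0r /line_weight; case: eqP => [CE|_]; last by rewrite nnr0.
by move: vC; rewrite CE verticalb_rem_add vA.
Qed.

Lemma wline_stoch m A k : verticalb m A -> \tsum_C \tsum_l wline m A k C l = 1.
Proof.
move=> vA; rewrite -(@line_weight_stoch _ _ q (alpha m) (nu m) m hq (halpha0 m) (hnu m) A k).
by apply: eq_tsum => C; apply: eq_tsum => l; rewrite wlineE.
Qed.

Lemma wqueue_stoch m A B : verticalb m A -> \tsum_C \tsum_D wqueue m A B C D = 1.
Proof.
move=> vA; have [W0 W1 _] := hqueue m; move/verticalP: (vA) => vA'.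
transitivity (tsum (fun o : vconf n * hconf n => wqueue m A B o.1 o.2)).
  by rewrite tsum_pair.
apply: nnval_inj; rewrite /= -(W1 A B vA') [RHS]esum_mkcond.
apply: eq_esum => -[C D] _ /=; rewrite vA (mem_vertical fst) /=.
by case: verticalP => [vC|_]; rewrite ?mul0e// mul1e ger0_norm// W0.
Qed.

Lemma wqp_stoch k B : \tsum_l \tsum_D wqp k B l D = 1.
Proof.
have [W0 W1 _] := hqp.
transitivity (tsum (fun o : color n * hconf n => wqp k B o.1 o.2)).
  by rewrite tsum_pair.
apply: nnval_inj; rewrite /= -(W1 k B); apply: eq_esum => o _ /=.
by rewrite ger0_norm.
Qed.

(** Conservation leaves the empty output as the only possible one, and stochasticity then gives it
    weight 1. *)
Lemma wqp_empty k V : wqp None (hzero n) k V = (k == None)%:R * (V == hzero n)%:R.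
Proof.
have [W0 W1 Wc] := hqp.
have nz l D : wqp None (hzero n) l D != 0 -> l = None /\ D = hzero n.
  rewrite nnr_eq0 => /Wc h; split.
    by case: l h => // i /(_ i); rewrite eqxx /hzero ffunE.
  apply/ffunP => i; have := h i; rewrite /hzero !ffunE /= => /esym /eqP.
  by rewrite addn_eq0 => /andP[_ /eqP].
have [->|k0] := eqVneq k None; last first.
  rewrite mul0r; apply/eqP; apply: contraNT k0 => /nz[-> _]; exact: eqxx.
have [->|V0] := eqVneq V (hzero n); last first.
  rewrite mulr0; apply/eqP; apply: contraNT V0 => /nz[_ ->]; exact: eqxx.
rewrite mulr1 -[RHS](wqp_stoch None (hzero n)).
rewrite (@tsum_supp1 _ _ None) => [|l l0]; last first.
  rewrite -[RHS](tsum0 R (hconf n)); apply: eq_tsum => D.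
  by apply/eqP; apply: contraNT l0 => /nz[-> _]; exact: eqxx.
rewrite (@tsum_supp1 _ _ (hzero n)) => [//|D D0].
by apply/eqP; apply: contraNT D0 => /nz[_ ->]; exact: eqxx.
Qed.

Lemma wline_wqueue_intertwined m : intertwined wqp (wline m) (wqueue m).
Proof.
move=> a b i I j J.
have [va|va] := boolP (verticalb m a); last first.
  by congr tsum; apply/funext => c; congr tsum; apply/funext => k;
     congr tsum; apply/funext => K; rewrite /wline /wqueue (negPf va) !(mul0r, mulr0).
have [vb|vb] := boolP (verticalb m b); last first.
  by congr tsum; apply/funext => c; congr tsum; apply/funext => k;
     congr tsum; apply/funext => K; rewrite /wline /wqueue (negPf vb) !andbF !(mul0r, mulr0).
have triple (F : vconf n -> color n -> hconf n -> nne R) :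
    \tsum_c \tsum_k \tsum_K F c k K =
    tsum (fun x : hconf n * color n * vconf n => F x.2 x.1.2 x.1.1).
  rewrite !tsum_pair [RHS]tsumC.
  rewrite tsumC; apply: eq_tsum => k /=; rewrite tsumC.
  by apply: eq_tsum.
rewrite !triple; apply: nnval_inj.
have := @hYB m a b I J i j (elimT (verticalP _ _) va) (elimT (verticalP _ _) vb).
rewrite esum_mkcond [in X in _ = X -> _]esum_mkcond => YB.
have [W0 _ _] := hqueue m; have [X0 _ _] := hqp.
have L0 := line_weight_ge0 m hq (halpha0 m) (hnu m).
transitivity (\esum_(x in [set: hconf n * color n * vconf n])
  (if x \in [set x | vertical m x.2] then
    (let: (K1, k2, K3) := x in
       line_weight q (alpha m) (nu m) m a i K3 k2 * Wqueue m K3 I b K1 *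
       Wqp k2 K1 j J)%:E else 0%E)).
  apply: eq_esum => -[[K k] c] _; rewrite (mem_vertical snd) /= va vb /=.
  case: verticalP => vc; last by rewrite !mul0e.
  rewrite !mul1e -!EFinM -!normrM ger0_norm//.
  by rewrite !mulr_ge0// W0//; apply/verticalP.
rewrite YB.
apply: eq_esum => -[[K k] c] _; rewrite (mem_vertical snd) /= va vb /=.
case: verticalP => vc; last by rewrite !mul0e !mule0.
rewrite !mul1e -!EFinM -!normrM ger0_norm//.
by rewrite !mulr_ge0// W0//; apply/verticalP.
Qed.

Definition line_row (M N : vstate n) (k : color n) : nne R :=
  rowsum wline M None N k.
Definition queue_row (M N : vstate n) (V : hconf n) : nne R :=
  rowsum wqueue M (hzero n) N V.

(** After the cross has crossed the whole row, its two inputs are the empty left edges, where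
    [wqp_empty] makes it a point mass. *)
Lemma row_exchange M N j J :
  \tsum_M1 \tsum_k \tsum_V (line_row M M1 k * queue_row M1 N V * wqp k V j J) =
  \tsum_M1 (queue_row M M1 J * line_row M1 N j).
Proof.
rewrite /line_row /queue_row (intertwined_rowsum wline_wqueue_intertwined).
apply: eq_tsum => c.
rewrite (@tsum_supp1 _ _ None) => [|k /negPf k0]; last first.
  rewrite -[RHS](tsum0 R (hconf n)); apply: eq_tsum => K.
  by rewrite wqp_empty k0 !mul0r.
rewrite (@tsum_supp1 _ _ (hzero n)) => [|K /negPf K0]; last first.
  by rewrite wqp_empty K0 mulr0 !mul0r.
by rewrite wqp_empty !eqxx !mul1r.
Qed.

Definition vertical_state (M : vstate n) : bool := [forall m, verticalb m (M m)].

Lemma line_row_stoch M : vertical_state M -> \tsum_N \tsum_k line_row M N k = 1.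
Proof. by move=> /forallP vM; apply: rowsum_stoch => m k; exact: wline_stoch. Qed.
Lemma queue_row_stoch M : vertical_state M -> \tsum_N \tsum_V queue_row M N V = 1.
Proof. by move=> /forallP vM; apply: rowsum_stoch => m k; exact: wqueue_stoch. Qed.

Lemma line_row_vertical M N k : line_row M N k != 0 -> vertical_state N.
Proof.
move=> /eqP h0; have [h [_ _ hw]] := rowsum_eq0 h0; apply/forallP => m; have := hw m.
apply: contraNT => /negPf vm; by rewrite /wline vm andbF mul0r.
Qed.

Lemma queue_row_vertical M N V : queue_row M N V != 0 -> vertical_state N.
Proof.
move=> /eqP h0; have [h [_ _ hw]] := rowsum_eq0 h0; apply/forallP => m; have := hw m.
apply: contraNT => /negPf vm; by rewrite /wqueue vm andbF mul0r.
Qed.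

End Kernels.

(** * Good states and their height *)

Section Counts.
Variable n : nat.
Implicit Types (A : vconf n) (x : vstate n).

Lemma add_arrow_None A : add_arrow A None = A.
Proof. by apply/ffunP => i; rewrite ffunE. Qed.
Lemma rem_arrow_None A : rem_arrow A None = A.
Proof. by apply/ffunP => i; rewrite ffunE. Qed.

Lemma sum_vcount_rem A l : (0 < vcount A l)%N ->
  (\sum_i vcount (rem_arrow A (Some l)) i).+1 = (\sum_i vcount A i)%N.
Proof.
move=> Al; rewrite (bigD1 l)//= [RHS](bigD1 l)//= -addSn; congr (_ + _)%N.
  rewrite {1}/vcount ffunE eqxx; move: Al; rewrite /vcount.
  by case: (A l) => // -[].
by apply: eq_bigr => i il; rewrite /vcount ffunE eq_sym (inj_eq Some_inj) (negPf il).
Qed.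

Lemma sum_vcount_add A l : A l != None ->
  (\sum_i vcount (add_arrow A (Some l)) i = (\sum_i vcount A i).+1)%N.
Proof.
move=> Al; rewrite (bigD1 l)//= [in RHS](bigD1 l)//= -addSn; congr (_ + _)%N.
  by rewrite {1}/vcount ffunE eqxx; move: Al; rewrite /vcount; case: (A l).
by apply: eq_bigr => i il; rewrite /vcount ffunE eq_sym (inj_eq Some_inj) (negPf il).
Qed.

(* Moving an arrow one column to the right decreases the height. *)
Definition state_height x : nat :=
  (\sum_(c < n) c.+1 * \sum_i vcount (x c) i)%N.

(* In column -(m+1) only the colors above m + 1 occur, besides m + 1 itself. *)
Definition good_state x : bool :=
  vertical_state x && [forall m : 'I_n, forall i : 'I_n, (i < m)%N ==> (x m i == Some 0%N)].

Lemma good_stateP x : reflect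
  ((forall m, vertical m (x m)) /\ forall m i : 'I_n, (i < m)%N -> x m i = Some 0%N)
  (good_state x).
Proof.
apply: (iffP andP) => -[v0 z0]; split.
- by move=> m; apply/verticalP; exact: (forallP v0).
- by move=> m i im; apply/eqP; move/forallP/(_ m)/forallP/(_ i)/implyP : z0; apply.
- by apply/forallP => m; apply/verticalP.
- by apply/forallP => m; apply/forallP => i; apply/implyP => im; rewrite z0.
Qed.

Definition empty_state : vstate n := [ffun m => vempty m].

Lemma good_empty : good_state empty_state.
Proof.
apply/good_stateP; split=> [m i|m i im]; rewrite !ffunE; first by case: (i == m).
by rewrite -val_eqE /= (ltn_eqF im).
Qed.

End Counts.

(** * Invariance of the steady law under a queue row *)

Section Stationary.
Variables (R : realType) (n : nat) (q : R) (alpha nu : 'I_n -> R).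
Variable Wqueue : 'I_n -> vconf n -> hconf n -> vconf n -> hconf n -> R.
Variable Wqp : color n -> hconf n -> color n -> hconf n -> R.
Hypothesis hq : 0 <= q < 1.
Hypothesis halpha0 : forall i, 0 < alpha i.
Hypothesis hnu : forall i, 0 <= nu i <= alpha i.
Hypothesis hqueue : forall m, stochastic_queue_weight m (Wqueue m).
Hypothesis hqp : stochastic_qp_weight Wqp.
Hypothesis hYB : forall m,
  yang_baxter m (line_weight q (alpha m) (nu m) m) (Wqueue m) Wqp.

Notation L := (line_row q alpha nu).
Notation Q := (queue_row Wqueue).

(** Columns left of column [i] contain no arrow of color [i], and none enters from the left
    boundary; by conservation none can appear there. *)
Lemma queue_row_good M N V : good_state M -> Q M N V != 0 -> good_state N.
Proof.
move=> /good_stateP[vM zM] /[dup] /queue_row_vertical/forallP vN /eqP h0.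
have [h [hmax _ hw]] := rowsum_eq0 h0.
have cons m i : omap (addn (h (lift ord0 m) i)) (M m i) =
    omap (addn (h (widen_ord (leqnSn n) m) i)) (N m i).
  have [_ _ Wc] := hqueue m; apply: Wc; rewrite ?vM//.
    exact/verticalP.
  have := hw m; rewrite /wqueue; apply: contraNneq => ->.
  by rewrite nnr0 mulr0.
have step (m : 'I_n) : (forall i : 'I_n, (i < m.+1)%N -> h (lift ord0 m) i = 0%N) ->
    forall i : 'I_n, (i < m)%N -> h (widen_ord (leqnSn n) m) i = 0%N /\ N m i = Some 0%N.
  move=> IH i im; have := cons m i; rewrite IH ?zM//; last exact: ltnW.
  by case: (N m i) => //= c [] /esym/eqP; rewrite addn_eq0 => /andP[/eqP -> /eqP ->].
(* Here [k] is the distance of the edge [p] from the left boundary. *)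
have all0 k : forall p : 'I_n.+1, (p + k = n)%N -> forall i : 'I_n, (i < p)%N -> h p i = 0%N.
  elim: k => [|k IH] p pk i ip.
    have -> : p = ord_max by apply: val_inj; move: pk; rewrite addn0.
    by rewrite hmax ffunE.
  have pn : (p < n)%N by lia.
  have := @step (Ordinal pn) _ i ip.
  have -> : widen_ord (leqnSn n) (Ordinal pn) = p by exact: val_inj.
  case=> // j jp; apply: IH => //.
  by rewrite lift0 /=; lia.
apply/good_stateP; split=> [m|m i im]; first exact/verticalP.
apply: (step m _ i im).2 => j jm; apply: (all0 (n - m.+1)%N) => //.
by rewrite lift0 /=; have := ltn_ord m; lia.
Qed.

(** No propagation from the boundary is needed here: a line coefficient vanishes for an exit color
    smaller than that of its column. *)
Lemma line_row_good M N k : good_state M -> L M N k != 0 -> good_state N.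
Proof.
move=> /good_stateP[vM zM] /[dup] /line_row_vertical/forallP vN /eqP h0.
have [h [hmax _ hw]] := rowsum_eq0 h0.
have lw m : line_weight q (alpha m) (nu m) m (M m) (h (lift ord0 m)) (N m)
    (h (widen_ord (leqnSn n) m)) != 0.
  have := hw m; rewrite /wline; apply: contraNneq => ->.
  by rewrite nnr0 mulr0.
have hp (p : 'I_n.+1) (i : 'I_n) : (i < p)%N -> h p != Some i.
  move=> ip; have [pn|] := ltnP p n; last first.
    move=> np; have -> : p = ord_max.
      by apply: val_inj; apply/eqP; rewrite eqn_leq np -ltnS ltn_ord.
    by rewrite hmax.
  have := lw (Ordinal pn); have -> : widen_ord (leqnSn n) (Ordinal pn) = p by exact: val_inj.
  apply: contra => /eqP ->; rewrite /line_weight /line_coef /= ip mulr0.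
  by rewrite if_same.
apply/good_stateP; split=> [m|m i im]; first exact/verticalP.
have := lw m; rewrite /line_weight; case: (N m =P _) => [-> _|_]; last by rewrite eqxx.
rewrite !ffunE (negPf (hp _ _ _)) ?(negPf (hp _ _ _)) ?zM//.
by rewrite lift0 /= ltnW.
Qed.

(* Move the largest color present in some column one column to the right. *)
Lemma good_descent x : good_state x -> x != empty_state n ->
  exists y, [/\ good_state y, \tsum_k L x y k != 0 &
               (state_height y < state_height x)%N].
Proof.
move=> /[dup] gx /good_stateP[vx zx] xe.
have [m [i0 i0P]] : exists m i, (0 < vcount (x m) i)%N.
  apply: contrapT => nP; move/eqP: xe; apply.
  apply/ffunP => m; apply/ffunP => i; rewrite !ffunE.
  case: eqP => [->|im]; first by apply/eqP; rewrite vx.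
  case E : (x m i) => [[|c]|]//.
    by exfalso; apply: nP; exists m, i; rewrite /vcount E.
  by move/eqP: E; rewrite vx => /eqP.
have [l lP lmax] := @arg_maxnP _ i0 (fun i => (0 < vcount (x m) i)%N) (fun i => i : nat) i0P.
have ml : (m < l)%N.
  rewrite ltnNge; apply/negP; rewrite leq_eqVlt => /orP[/eqP/val_inj E|lm].
    by move: lP; rewrite E /vcount; have /eqP -> : x m m == None by rewrite vx.
  by move: lP; rewrite /vcount zx.
(* The color [l] occupies only the right edge of column [m]. If this is column 0, the arrow leaves
   the system. *)
pose h := [ffun p : 'I_n.+1 => if p == m :> nat then Some l else None].
pose y : vstate n := [ffun c =>
  rem_arrow (add_arrow (x c) (h (lift ord0 c))) (h (widen_ord (leqnSn n) c))].
have hl c : h (lift ord0 c) = if c.+1 == m :> nat then Some l else None.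
  by rewrite ffunE lift0.
have hr c : h (widen_ord (leqnSn n) c) = if c == m then Some l else None.
  by rewrite ffunE.
have yE c : y c = rem_arrow (add_arrow (x c)
    (if c.+1 == m :> nat then Some l else None)) (if c == m then Some l else None).
  by rewrite ffunE hl hr.
exists y; split.
- apply/good_stateP; split=> [c|c i ic].
    by apply/verticalP; rewrite yE verticalb_rem_add; apply/verticalP.
  have cl : (c.+1 == m :> nat) || (c == m) -> Some l != Some i.
    move=> cm; apply/eqP => -[li]; move: cm ml; rewrite li -val_eqE /=; lia.
  rewrite yE !ffunE zx//; move: cl.
  by case: (c.+1 == m :> nat); case: (c == m) => //= /(_ isT)/negPf ->.
- suff p0 : \prod_(c < n) wline q alpha nu c (x c) (h (lift ord0 c)) (y c)
      (h (widen_ord (leqnSn n) c)) != 0.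
    have hmax : h ord_max = None by rewrite ffunE /= gtn_eqF.
    have le1 := le_rowsum (wline q alpha nu) x y hmax (erefl (h ord0)).
    apply: contra p0 => /eqP /tsum_eq0 /(_ (h ord0)) L0.
    apply/eqP/nnval_eq0/eqP; rewrite eq_le nne_ge0 andbT.
    by apply: le_trans le1 _; rewrite -/(line_row _ _ _ _ _ _) L0.
  rewrite (eq_bigr (fun c => nnr (line_weight q (alpha c) (nu c) c (x c)
    (h (lift ord0 c)) (y c) (h (widen_ord (leqnSn n) c))))); last first.
    by move=> c _; rewrite wlineE//; exact/verticalP.
  rewrite -nnr_prod nnr_eq0; apply/prodf_neq0 => c _.
  rewrite /line_weight ffunE eqxx mulf_neq0//.
    by rewrite invr_neq0// gt_eqF// addr_gt0.
  rewrite hl hr; case: (c =P m) => [cm|_]; last by rewrite /= oner_neq0.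
  have lm : (l == m) = false by rewrite -val_eqE /= gtn_eqF.
  rewrite cm gtn_eqF// /line_coef ltnNge (ltnW ml) /= lm.
  (* This is where maximality of [l] is used: a factor [q ^+ vtail] with positive exponent would
     vanish for [q = 0]. *)
  have -> : vtail (x m) l = 0%N.
    rewrite /vtail big1// => j lj; apply/eqP; rewrite -leqn0 leqNgt.
    by apply/negP => /lmax /=; move: lj; lia.
  rewrite expr0 mulr1 mulf_neq0 ?gt_eqF//= subr_gt0.
  by case/andP: hq => q0 q1; rewrite exprn_ilt1//; case: (vcount (x m) l) lP.
- have w c : ((\sum_i vcount (y c) i) + (c == m) =
      (\sum_i vcount (x c) i) + (c.+1 == m :> nat))%N.
    rewrite yE; case: (c =P m) => [->|_].
      by rewrite gtn_eqF// add_arrow_None addn0 addn1 sum_vcount_rem.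
    rewrite rem_arrow_None addn0; case: eqP => [cm|_]; last first.
      by rewrite add_arrow_None addn0.
    rewrite sum_vcount_add ?addn1// vx; apply/eqP => lc.
    by move: ml; rewrite lc; lia.
  (* Column [m] loses an arrow of weight [m + 1]; the column to its right gains one of weight [m],
     or there is no such column when [m] is 0. *)
  have H : (state_height y + m.+1 = state_height x +
      \sum_(c < n) c.+1 * (c.+1 == m :> nat))%N.
    rewrite /state_height -big_split /=.
    under [RHS]eq_bigr => c _ do rewrite -mulnDr -w mulnDr.
    rewrite [RHS]big_split /=; congr (_ + _)%N.
    by rewrite (bigD1 m)//= eqxx muln1 big1 ?addn0// => c /negPf ->; rewrite muln0.
  suff : (\sum_(c < n) c.+1 * (c.+1 == m :> nat) <= m)%N by move: H; lia.
  have [->|m0] := posnP m; first by rewrite big1// => c _; rewrite muln0.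
  have m1 : (m.-1 < n)%N by have := ltn_ord m; lia.
  rewrite (bigD1 (Ordinal m1))//= prednK// eqxx muln1 big1 ?addn0// => c cm.
  case: eqP => [cE|]; last by rewrite muln0.
  by move/eqP: cm; case; apply: val_inj => /=; rewrite -cE.
Qed.

Lemma queue_stationary (f : vstate n -> nne R) :
  (forall M, f M != 0 -> good_state M) -> tsum f = 1 ->
  (forall N, \tsum_M \tsum_k (f M * L M N k) = f N) ->
  queue_step Q f =1 f.
Proof.
move=> fg f1 fL.
have fQg N : queue_step Q f N != 0 -> good_state N.
  apply: contraNT => ngN; apply/eqP; rewrite -(tsum0 R (vstate n)).
  apply: eq_tsum => M; rewrite -[RHS](tsum0 R (hconf n)); apply: eq_tsum => V.
  have [->|/fg gM] := eqVneq (f M) 0; first by rewrite mul0r.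
  have [->|/(queue_row_good gM)] := eqVneq (Q M N V) 0; first by rewrite mulr0.
  by rewrite (negPf ngN).
have good_vert M : good_state M -> vertical_state M by case/andP.
have K1 M : good_state M -> \tsum_N \tsum_k L M N k = 1.
  by move=> /good_vert; exact: line_row_stoch.
apply: (@stationary_unique _ _ (fun M N => \tsum_k L M N k) (@good_state n)
  (@state_height n) (empty_state n)) => //.
- exact: good_descent.
(* A queue row preserves total mass on vertical states. *)
- rewrite /queue_step tsumC -[RHS]f1; apply: eq_tsum => M.
  rewrite tsumC.
  under eq_tsum => V do rewrite -tsumMr.
  rewrite -tsumMr tsumC.
  have [->|/fg/good_vert gM] := eqVneq (f M) 0; first by rewrite mul0r.
  by rewrite queue_row_stoch// mulr1.
- move=> N.
  transitivity (\tsum_M1 \tsum_M \tsum_V \tsum_j (f M * (Q M M1 V * L M1 N j))).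
    apply: eq_tsum => M1; rewrite /queue_step tsumMl; apply: eq_tsum => M.
    rewrite tsumMl; apply: eq_tsum => V; rewrite -mulrA -tsumMr; congr (_ * _).
    by rewrite tsumMr.
  (* Exchange the two rows under the sum over all exits. The outputs of the cross are then free, and
     it sums to 1. *)
  transitivity (\tsum_M (f M * \tsum_M1 \tsum_k \tsum_V
      (L M M1 k * Q M1 N V))).
    rewrite tsumC; apply: eq_tsum => M.
    rewrite tsumC.
    under eq_tsum => V do rewrite tsumC.
    under eq_tsum => V do under eq_tsum => j do rewrite -tsumMr
      -(row_exchange hq halpha0 hnu hqueue hqp hYB).
    under eq_tsum => V do rewrite -tsumMr.
    rewrite -tsumMr; congr (_ * _).
    under eq_tsum => V do rewrite -tsum3C.
    rewrite -tsum3C; apply: eq_tsum => M1; apply: eq_tsum => k.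
    apply: eq_tsum => W; rewrite tsumC.
    under eq_tsum => j do rewrite -tsumMr.
    by rewrite -tsumMr (wqp_stoch hqp) mulr1.
  under eq_tsum => M do rewrite tsumMr3.
  rewrite tsumC; apply: eq_tsum => M1.
  under eq_tsum => M do rewrite tsumC.
  rewrite tsumC; apply: eq_tsum => V.
  (* The line row now comes first and is absorbed by the invariance of [f]. *)
  rewrite -[in RHS]fL tsumMl; apply: eq_tsum => M.
  by rewrite tsumMl; apply: eq_tsum => k; rewrite mulrA.
- by move=> N; rewrite -[RHS]fL; apply: eq_tsum => M; rewrite tsumMr.
Qed.

End Stationary.

(** * Discrete random variables *)

Section DiscreteVariables.
Context (disp : measure_display) (Om : measurableType disp).

Definition discrete_variable (T : Type) (X : Om -> T) : Prop :=
  forall x, measurable [set w | X w = x].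

Lemma discrete_variable_measurable (T : countType) (X : Om -> T) (A : set T) :
  discrete_variable X -> measurable [set w | A (X w)].
Proof.
move=> dX; pose F (i : nat) : set Om :=
  if pickle_inv i is Some x then
    if x \in A then [set w | X w = x] else set0 else set0.
have -> : [set w | A (X w)] = \bigcup_i F i.
  apply/seteqP; split=> [w AXw|w [i _]].
    by exists (pickle (X w)) => //; rewrite /F pickleK_inv mem_set.
  rewrite /F; case: pickle_inv => // x; case: ifPn => // /set_mem Ax /= Xx.
  by rewrite Xx.
apply: bigcup_measurable => i _; rewrite /F.
case: pickle_inv => [x|]; last exact: measurable0.
by case: ifP => _; [exact: dX|exact: measurable0].
Qed.

Lemma discrete_pair (T U : Type) (X : Om -> T) (Y : Om -> U) :
  discrete_variable X -> discrete_variable Y ->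
  discrete_variable (fun w => (X w, Y w)).
Proof.
move=> dX dY [x y].
rewrite (_ : [set w | _] = [set w | X w = x] `&` [set w | Y w = y]).
  exact: measurableI.
by apply/seteqP; split=> w /= => [[-> ->]|[-> ->]].
Qed.

Lemma measurable_forall_ord r (A : 'I_r -> set Om) :
  (forall i, measurable (A i)) -> measurable [set w | forall i, A i w].
Proof.
elim: r A => [|r IH] A mA.
  rewrite (_ : [set w | _] = setT); first exact: measurableT.
  by apply/seteqP; split=> // w _ [i lti]; exfalso; move: lti; rewrite ltn0.
rewrite (_ : [set w | _] =
    A ord0 `&` [set w | forall i, A (lift ord0 i) w]).
  by apply: measurableI => //; apply: IH => i; exact: mA.
apply/seteqP; split=> w /= => [Aw|[A0 AS] i]; first by split.
by case: (unliftP ord0 i) => [j ->|->].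
Qed.

Lemma discrete_ffun r (T : Type) (X : 'I_r -> Om -> T) :
  (forall i, discrete_variable (X i)) ->
  discrete_variable (fun w => [ffun i => X i w]).
Proof.
move=> dX f.
rewrite (_ : [set w | _] = [set w | forall i, [set w | X i w = f i] w]).
  by apply: measurable_forall_ord => i; exact: dX.
apply/seteqP; split=> w /= => [<- i|Xf]; first by rewrite ffunE.
by apply/ffunP => i; rewrite ffunE.
Qed.

Lemma discrete_mktuple r (T : Type) (X : 'I_r -> Om -> T) :
  (forall i, discrete_variable (X i)) ->
  discrete_variable (fun w => mktuple (X ^~ w)).
Proof.
move=> dX t.
rewrite (_ : [set w | _] = [set w | forall i, [set w | X i w = tnth t i] w]).
  by apply: measurable_forall_ord => i; exact: dX.
apply/seteqP; split=> w /= => [<- i|Xt]; first by rewrite tnth_mktuple.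
by apply: eq_from_tnth => i; rewrite tnth_mktuple.
Qed.

Variables (R : realType) (P : probability Om R).

Definition prb (A : set Om) : nne R := NNE (measure_ge0 P A).

(** The fibers of [X] are indexed by natural numbers through [pickle]; a number that encodes no
    value contributes an empty set. *)
Lemma prb_partition (T : countType) (X : Om -> T) (A : set Om) :
  discrete_variable X -> measurable A ->
  prb A = \tsum_x prb (A `&` [set w | X w = x]).
Proof.
move=> dX mA; pose F (i : nat) := A `&` [set w | pickle (X w) = i].
have AE : A = \bigcup_i F i.
  apply/seteqP; split=> [w Aw|w [i _ []]//]; by exists (pickle (X w)).
have mF i : measurable (F i).
  apply: measurableI => //.
  exact: (discrete_variable_measurable [set x | pickle x = i] dX).
have tF : trivIset setT F.
  by move=> i j _ _ [w [[_ <-] [_ <-]]].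
transitivity (\tsum_i prb (F i)).
  apply: nnval_inj; rewrite /= {1}AE measure_bigcup//.
  rewrite -nneseries_esumT; last by move=> i; exact: measure_ge0.
  by apply: eq_eseriesl => i; rewrite in_setT.
transitivity (\tsum_i \tsum_x ((pickle x == i)%:R * prb (A `&` [set w | X w = x]))).
  apply: eq_tsum => i; case E : (pickle_inv i : option T) => [x|].
    have pxi : pickle x = i by have := @pickle_invK T i; rewrite E.
    rewrite (@tsum_supp1 _ _ x) => [|y yx].
      rewrite pxi eqxx mul1r; congr prb; apply/seteqP.
      split=> w [Aw /=]; rewrite -pxi; first by move/(pcan_inj pickleK_inv).
      by move=> Xw; split=> //=; rewrite Xw.
    by rewrite -pxi (inj_eq (pcan_inj pickleK_inv)) (negPf yx) mul0r.
  have -> : F i = set0.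
    by apply/seteqP; split=> // w [_ /=] Xi; move: E; rewrite -Xi pickleK_inv.
  have -> : prb set0 = 0 by apply: nnval_inj; exact: measure0.
  rewrite -[LHS](tsum0 R T); apply: eq_tsum => x.
  case: eqP => [xi|_]; last by rewrite mul0r.
  by exfalso; move: E; rewrite -xi pickleK_inv.
rewrite tsumC; apply: eq_tsum => x.
rewrite (@tsum_supp1 _ _ (pickle x)) ?eqxx ?mul1r// => i.
by rewrite eq_sym => /negPf ->; rewrite mul0r.
Qed.

Lemma prb_setT : prb setT = 1.
Proof. by apply: nnval_inj; rewrite /= probability_setT. Qed.

Lemma tsum_prb (T : countType) (X : Om -> T) : discrete_variable X ->
  \tsum_x prb [set w | X w = x] = 1.
Proof.
move=> dX; rewrite -prb_setT (prb_partition dX measurableT).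
by apply: eq_tsum => x; rewrite setTI.
Qed.

End DiscreteVariables.

(** * The steady state *)

Lemma tsum_fiber (R : realType) (T U : choiceType) (f : T -> U)
    (A : T -> nne R) (B : U -> nne R) :
  \tsum_y ((\tsum_x ((f x == y)%:R * A x)) * B y) = \tsum_x (A x * B (f x)).
Proof.
under eq_tsum => y do rewrite tsumMl.
rewrite tsumC; apply: eq_tsum => x.
rewrite (@tsum_supp1 _ _ (f x)) ?eqxx ?mul1r// => y.
by rewrite eq_sym => /negPf ->; rewrite !mul0r.
Qed.

Section Rectangle.
Variables (R : realType) (n : nat) (q : R) (alpha nu : 'I_n -> R).

Definition line_edge_row (M : vstate n) (h : {ffun 'I_n.+1 -> color n})
    (N : vstate n) : nne R :=
  (h ord_max == None)%:R *
  \prod_(m < n) nnr (line_weight q (alpha m) (nu m) m (M m) (h (lift ord0 m))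
                       (N m) (h (widen_ord (leqnSn n) m))).

Definition line_rect k (g : {ffun 'I_k.+1 -> vstate n})
    (hh : {ffun 'I_k -> {ffun 'I_n.+1 -> color n}}) : nne R :=
  (g ord_max == empty_state n)%:R *
  \prod_(j < k) line_edge_row (g (lift ord0 j)) (hh j) (g (widen_ord (leqnSn k) j)).

(** Only rows present in the rectangle are constrained. In the limit [r] stays fixed, so eventually
    all [r] of them are. *)
Definition exits_agree k r (d : nat -> color n)
    (hh : {ffun 'I_k -> {ffun 'I_n.+1 -> color n}}) : bool :=
  [forall j : 'I_k, (j < r)%N ==> (hh j ord0 == d j)].

(* [line_edges K] has [K + 1] rows; here [k = 0] rows are allowed, so that
   inductions start from the empty state. *)
Definition rect_law k r (d : nat -> color n) (M : vstate n) : nne R :=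
  tsum (fun g : {ffun 'I_k.+1 -> vstate n} => (g ord0 == M)%:R *
    tsum (fun hh : {ffun 'I_k -> {ffun 'I_n.+1 -> color n}} =>
      (exits_agree r d hh)%:R * line_rect g hh)).

(* [line_row] without its restriction to vertical tuples, which is absent from
   [line_edges_prob]. *)
Definition line_row_all (M N : vstate n) (c : color n) : nne R :=
  rowsum (fun m A k C l => nnr (line_weight q (alpha m) (nu m) m A k C l)) M None N c.

Lemma rect_law0 r d M : rect_law 0 r d M = (M == empty_state n)%:R.
Proof.
rewrite /rect_law tsum_ffunS.
under eq_tsum => a.
  rewrite (@tsum_ffun0 _ _ _ [ffun=> a]) ffcons0.
  rewrite (@tsum_ffun0 _ _ _ [ffun=> [ffun=> None]]).
  rewrite /line_rect big_ord0 mulr1 (_ : ord_max = ord0); last exact: val_inj.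
  rewrite ffcons0 (_ : exits_agree _ _ _ = true) ?mul1r; last first.
    by apply/forallP => -[].
  over.
by rewrite tsum_delta.
Qed.

Lemma exits_agreeS k r d h (hh : {ffun 'I_k -> {ffun 'I_n.+1 -> color n}}) :
  exits_agree r d (ffcons h hh) =
  ((0 < r)%N ==> (h ord0 == d 0%N)) && exits_agree r.-1 (fun i => d i.+1) hh.
Proof.
apply/forallP/andP => [H|[H0 /forallP H] j].
  split; first by have := H ord0; rewrite ffcons0.
  apply/forallP => j; have := H (lift ord0 j); rewrite ffconsS lift0.
  by case: r {H}.
case: (unliftP ord0 j) => [i ->|->]; last by rewrite ffcons0.
have := H i; rewrite ffconsS lift0; by case: r {H0 H}.
Qed.

(** Row 0 is the top row, so the recursion removes the last row that is run. The implication and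
    [r.-1] cover [r = 0], where its exit is unconstrained. *)
Lemma rect_lawS k r d M : rect_law k.+1 r d M =
  \tsum_N \tsum_c (rect_law k r.-1 (fun i => d i.+1) N *
     (((0 < r)%N ==> (c == d 0%N))%:R * line_row_all N M c)).
Proof.
under [RHS]eq_tsum => N do rewrite -tsumMr /rect_law.
rewrite tsum_fiber /rect_law tsum_ffunS.
rewrite (@tsum_supp1 _ _ M) => [|a /negPf aM]; last first.
  rewrite -[RHS](tsum0 R {ffun 'I_k.+1 -> vstate n}); apply: eq_tsum => g.
  by rewrite ffcons0 aM mul0r.
apply: eq_tsum => g; rewrite ffcons0 eqxx mul1r tsum_ffunS tsumC tsumMl.
apply: eq_tsum => hh.
transitivity (tsum (fun h : {ffun 'I_n.+1 -> color n} =>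
  (exits_agree r.-1 (fun i => d i.+1) hh)%:R *
  line_rect g hh * (((0 < r)%N ==> (h ord0 == d 0%N))%:R *
    line_edge_row (g ord0) h M))).
  apply: eq_tsum => h; rewrite exits_agreeS /line_rect big_ord_recl ffcons0.
  have -> : ord_max = lift ord0 (@ord_max k) by exact: val_inj.
  rewrite !ffconsS (_ : widen_ord _ ord0 = ord0); last exact: val_inj.
  rewrite ffcons0.
  under eq_bigr => j _.
    rewrite !ffconsS (_ : widen_ord _ (lift ord0 j) =
      lift ord0 (widen_ord (leqnSn k) j)); last exact: val_inj.
    rewrite ffconsS.
    over.
  rewrite -mulnb natrM; ring.
rewrite -tsumMr; congr (_ * _).
rewrite /line_row_all /rowsum.
under [RHS]eq_tsum => c do rewrite tsumMr.
rewrite [RHS]tsumC; apply: eq_tsum => h.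
rewrite (@tsum_supp1 _ _ (h ord0)) => [|c]; last first.
  by rewrite eq_sym => /negPf ->; rewrite mulr0 mul0r mulr0.
by rewrite eqxx mulr1.
Qed.

Lemma line_exits_prob_rect K r (d : nat -> color n) M : (r <= K.+1)%N ->
  0 <= q < 1 -> (forall i, 0 < alpha i) -> (forall i, 0 <= nu i <= alpha i) ->
  line_exits_prob q alpha nu K [set (M, [ffun i : 'I_r => d i])] =
  nnval (rect_law K.+1 r d M).
Proof.
move=> rK hq halpha0 hnu.
transitivity (nnval (tsum (fun c : {ffun 'I_K.+2 -> vstate n} *
    {ffun 'I_K.+1 -> {ffun 'I_n.+1 -> color n}} =>
    (c.1 ord0 == M)%:R * ((exits_agree r d c.2)%:R * line_rect c.1 c.2)))); last first.
  rewrite tsum_pair /rect_law; congr nnval; apply: eq_tsum => g.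
  by rewrite [RHS]tsumMr; apply: eq_tsum.
rewrite /line_exits_prob [LHS]esum_mkcond; apply: eq_esum => -[g hh] _ /=.
have L0 m := line_weight_ge0 m hq (halpha0 m) (hnu m).
have -> : ((g, hh) \in [set c | [set (M, [ffun i : 'I_r => d i])]
      (line_exits r (c : line_edges n K))])
    = (g ord0 == M) && exits_agree r d hh.
  apply/idP/andP; rewrite inE /= /line_exits.
    case=> /= -> /ffunP dE; split=> //; apply/forallP => j; apply/implyP => jr.
    have := dE (Ordinal jr); rewrite !ffunE /= => <-.
    by rewrite inord_val.
  case=> /eqP -> /forallP H; congr (_, _); apply/ffunP => i; rewrite !ffunE.
  have iK : (i < K.+1)%N by exact: leq_trans rK.
  by have := H (inord i); rewrite inordK// ltn_ord /= => /eqP.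
case: (g ord0 == M); rewrite /= ?mul0e//.
case: (exits_agree r d hh); rewrite /= ?mul0e ?mule0// !mul1e.
rewrite -nnval_nnr /line_edges_prob; last first.
  rewrite mulr_ge0//; apply: prodr_ge0 => j _; apply: prodr_ge0 => m _.
  exact: L0.
rewrite nnrM nnr_bool nnr_prod -mulnb natrM -mulrA.
rewrite -[RHS]nnvalM; congr (nnval (_ * _)) => /=.
under [RHS]eq_bigr do rewrite /line_edge_row.
rewrite big_split /=; congr (_ * _); last first.
  by apply: eq_bigr => j _; rewrite nnr_prod.
(* The left boundary condition is one global indicator in [line_edges_prob], but one factor per row
   in [line_rect]. *)
have [/forallP H|] := boolP [forall j, hh j ord_max == None].
  by rewrite big1// => j _; rewrite H.
rewrite negb_forall => /existsP[j /negPf hj].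
by rewrite (bigD1 j)//= hj mul0r.
Qed.

End Rectangle.

Section SteadyLaw.
Variables (R : realType) (n : nat) (q : R) (alpha nu : 'I_n -> R).
Hypothesis hq : 0 <= q < 1.
Hypothesis halpha0 : forall i, 0 < alpha i.
Hypothesis hnu : forall i, 0 <= nu i <= alpha i.
Context (disp : measure_display) (Om : measurableType disp).
Variables (P : probability Om R) (Mv : Om -> vstate n) (dd : nat -> Om -> color n).
Hypothesis dMv : discrete_variable Mv.
Hypothesis ddd : forall i, discrete_variable (dd i).
Hypothesis hsteady : steady_state q alpha nu P Mv dd.

Notation L := (line_row q alpha nu).

Definition bottom_event r (d : nat -> color n) (M : vstate n) : set Om :=
  [set w | Mv w = M /\ forall i, (i < r)%N -> dd i w = d i].

Definition bottom_law r d M : nne R := prb P (bottom_event r d M).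

Lemma bottom_event_measurable r d M : measurable (bottom_event r d M).
Proof.
rewrite (_ : bottom_event r d M = [set w | Mv w = M] `&`
   [set w | forall i : 'I_r, [set w | dd i w = d i] w]).
  apply: measurableI => //; apply: measurable_forall_ord => i; exact: ddd.
apply/seteqP; split=> w /= [Mw H]; split=> // i; first exact: H.
by move=> ir; exact: (H (Ordinal ir)).
Qed.

Lemma rect_law_cvg r d M :
  nnval (rect_law q alpha nu K.+1 r d M) @[K --> \oo] --> nnval (bottom_law r d M).
Proof.
have := @hsteady r [set (M, [ffun i : 'I_r => d i])].
rewrite (_ : P _ = nnval (bottom_law r d M)); last first.
  rewrite /bottom_law /=; congr (P _); apply/seteqP; split=> w /=.
    by case=> Mw /ffunP H; split=> // i ir; have := H (Ordinal ir); rewrite !ffunE.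
  by case=> -> H; congr (_, _); apply/ffunP => i; rewrite !ffunE H.
apply: cvg_trans; apply: near_eq_cvg; exists r => // K /= rK.
by rewrite line_exits_prob_rect// leqW.
Qed.

Lemma line_row_all_vertical M N k : vertical_state M ->
  line_row_all q alpha nu M N k = L M N k.
Proof.
move=> /forallP vM; apply: eq_tsum => h; congr (_ * _).
by apply: eq_bigr => m _; rewrite wlineE.
Qed.

Lemma le_line_row_all M N k :
  (nnval (L M N k) <= nnval (line_row_all q alpha nu M N k))%E.
Proof.
have [vM|] := boolP (vertical_state M); first by rewrite line_row_all_vertical.
rewrite negb_forall => /existsP[m vm]; rewrite [L M N k](_ : _ = 0) ?nne_ge0//.
rewrite -(tsum0 R {ffun 'I_n.+1 -> color n}); apply: eq_tsum => h.
by rewrite (bigD1 m)//= /wline (negPf vm) !mul0r mulr0.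
Qed.

Lemma rect_law_good k r d M : rect_law q alpha nu k r d M != 0 -> good_state M.
Proof.
elim: k r d M => [|k IH] r d M.
  rewrite rect_law0; case: (M =P _) => [-> _|_]; first exact: good_empty.
  by rewrite eqxx.
rewrite rect_lawS; apply: contraNT => nM; apply/eqP.
rewrite -(tsum0 R (vstate n)); apply: eq_tsum => N.
rewrite -[RHS](tsum0 R (color n)); apply: eq_tsum => c.
have [->|/IH gN] := eqVneq (rect_law q alpha nu k r.-1 (fun i => d i.+1) N) 0.
  by rewrite mul0r.
rewrite line_row_all_vertical; last by case/andP: gN.
have [->|/(line_row_good gN)] := eqVneq (L N M c) 0; first by rewrite !mulr0.
by rewrite (negPf nM).
Qed.

(** The rectangles start from the empty state, so their laws vanish off good states, and so does the
    limit. *)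
Lemma bottom_law_good r d M : bottom_law r d M != 0 -> good_state M.
Proof.
apply: contraNT => nM; apply/eqP/nnval_inj; apply/eqP.
rewrite eq_le nne_ge0 andbT; apply: cvge_to_le (@rect_law_cvg r d M) _.
apply: nearW => K; rewrite [rect_law _ _ _ _ _ _ _](_ : _ = 0)//.
by apply/eqP; apply: contraNT nM; exact: rect_law_good.
Qed.

Lemma line_row_fin M N k : (nnval (L M N k) < +oo)%E.
Proof.
have [vM|] := boolP (vertical_state M).
  apply: le_lt_trans (tsum_ge_term _ k) _.
  apply: le_lt_trans (tsum_ge_term (fun N => \tsum_k L M N k) N) _.
  by rewrite line_row_stoch// ltry.
rewrite negb_forall => /existsP[m vm]; rewrite [L M N k](_ : _ = 0) ?ltry//.
rewrite -(tsum0 R {ffun 'I_n.+1 -> color n}); apply: eq_tsum => h.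
by rewrite (bigD1 m)//= /wline (negPf vm) !mul0r mulr0.
Qed.

(** A Fatou argument on [rect_lawS]: every finite part of the sum over [N] converges and is bounded
    by the whole, but the sum itself could lose mass in the limit. *)
Lemma bottom_law_ge r d M :
  (nnval (\tsum_N (bottom_law r (fun i => d i.+1) N * L N M (d 0%N)))%R <=
   nnval (bottom_law r.+1 d M))%E.
Proof.
apply: ge_ereal_sup => _ [X [finX _] <-]; rewrite fsbig_finite//.
pose e K N := rect_law q alpha nu K.+1 r (fun i => d i.+1) N.
have lhs : (\sum_(N <- fset_set X) nnval (e K N * L N M (d 0%N))%R)%E @[K --> \oo] -->
   (\sum_(N <- fset_set X) nnval (bottom_law r (fun i => d i.+1) N * L N M (d 0%N))%R)%E.
  apply: cvg_nnesum => N _; first by apply: nearW => K; exact: nne_ge0.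
  rewrite nnvalM; under eq_fun do rewrite nnvalM.
  apply: cvgeZr; first by rewrite ge0_fin_numE ?nne_ge0 ?line_row_fin.
  exact: rect_law_cvg.
(* This rectangle has one row more than those in [e], which does not change the limit. *)
have rhs : nnval (rect_law q alpha nu K.+2 r.+1 d M) @[K --> \oo] -->
    nnval (bottom_law r.+1 d M).
  by have := @rect_law_cvg r.+1 d M; rewrite -cvg_shiftS.
apply: lee_cvg_to lhs rhs _; apply: nearW => K.
apply: (@le_trans _ _ (nnval (\tsum_N
    (e K N * line_row_all q alpha nu N M (d 0%N))))).
  apply: esum_ge; exists X => //; rewrite fsbig_finite//.
  apply: lee_sum => N _; rewrite !nnvalM.
  exact: lee_wpmul2l (nne_ge0 _) _ _ (le_line_row_all _ _ _).
rewrite /e rect_lawS; apply: tsum_le => N.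
rewrite (@tsum_supp1 _ _ (d 0%N)) ?eqxx ?mul1r// => c /negPf ->.
by rewrite mul0r mulr0.
Qed.

Lemma bottom_law_ext r d d' M : (forall i, (i < r)%N -> d i = d' i) ->
  bottom_law r d M = bottom_law r d' M.
Proof.
move=> dd'; congr prb; apply/seteqP; split=> w /= [Mw H]; split=> // i ir.
  by rewrite H ?dd'.
by rewrite H// dd'.
Qed.

Lemma bottom_law_mass r :
  tsum (fun x : vstate n * r.-tuple (color n) => bottom_law r (nth None x.2) x.1) = 1.
Proof.
rewrite -(tsum_prb P (X := fun w => (Mv w, mktuple (fun i : 'I_r => dd i w)))); last first.
  by apply: discrete_pair => //; apply: (discrete_mktuple (X := fun i : 'I_r => dd i)).
apply: eq_tsum => -[M t]; congr prb; apply/seteqP; split=> w /=.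
  case=> -> H; congr (_, _); apply: eq_from_tnth => i; rewrite tnth_mktuple H//.
  by rewrite -tnth_nth.
case=> Mw <-; split=> // i ir.
by rewrite (nth_mktuple _ _ (Ordinal ir)).
Qed.

(* In the limit only [bottom_law_ge] survives, but both sides have mass 1. *)
Lemma bottom_lawS r d M : bottom_law r.+1 d M =
  \tsum_N (bottom_law r (fun i => d i.+1) N * L N M (d 0%N)).
Proof.
pose G (x : vstate n * r.+1.-tuple (color n)) := bottom_law r.+1 (nth None x.2) x.1.
pose F (x : vstate n * r.+1.-tuple (color n)) :=
  \tsum_N (bottom_law r (fun i => nth None x.2 i.+1) N * L N x.1 (nth None x.2 0%N)).
have G1 : tsum G = 1 by exact: bottom_law_mass.
have FG : F =1 G.
  apply: tsum_le_eq; last by rewrite G1 ltry.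
    by move=> x; exact: bottom_law_ge.
  rewrite G1 -(bottom_law_mass r) [LHS]tsum_pair [RHS]tsum_pair tsumC.
  rewrite [RHS]tsumC tsum_tupleS tsumC; apply: eq_tsum => t; rewrite /F /=.
  under eq_tsum => c do rewrite tsumC.
  rewrite tsumC; apply: eq_tsum => N.
  under eq_tsum => c do rewrite -tsumMr.
  rewrite -tsumMr tsumC.
  change (bottom_law r (nth None t) N * (\tsum_M1 \tsum_c L N M1 c) =
    bottom_law r (nth None t) N).
  have [->|/bottom_law_good/andP[vN _]] := eqVneq (bottom_law r (nth None t) N) 0.
    by rewrite mul0r.
  by rewrite line_row_stoch// mulr1.
(* [FG] speaks of tuples, over which masses can be summed; only the first [r + 1] values of [d]
   matter. *)
pose t := mktuple (fun i : 'I_r.+1 => d i).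
have td i : (i < r.+1)%N -> nth None t i = d i.
  by move=> ir; rewrite (nth_mktuple _ _ (Ordinal ir)).
have := FG (M, t); rewrite /F /G /=.
rewrite (@bottom_law_ext r.+1 d (nth None t)); last by move=> i ir; rewrite td.
move=> <-; apply: eq_tsum => N; rewrite td//; congr (_ * _).
by apply: bottom_law_ext => i ir; rewrite td.
Qed.

Lemma bottom_law_line r d M :
  bottom_law r d M = line_law L r d (bottom_law 0 d) M.
Proof.
have e0 d' : bottom_law 0 d' = bottom_law 0 d.
  by apply/funext => N; exact: bottom_law_ext.
elim: r d M e0 => [//|r IH] d M e0.
rewrite bottom_lawS /=; apply: eq_tsum => N; rewrite IH; last first.
  by move=> d'; rewrite !(e0 _).
by rewrite e0.
Qed.

Lemma bottom_law0_mass d : tsum (bottom_law 0 d) = 1.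
Proof.
rewrite -(tsum_prb P dMv); apply: eq_tsum => M; congr prb.
by apply/seteqP; split=> w //= [].
Qed.

(** This is [bottom_lawS] at [r = 0] after the color emitted by the top row has been summed out. *)
Lemma bottom_law0_invariant d N :
  \tsum_M \tsum_k (bottom_law 0 d M * L M N k) = bottom_law 0 d N.
Proof.
rewrite tsumC /bottom_law (prb_partition P (ddd 0) (bottom_event_measurable 0 d N)).
apply: eq_tsum => k.
transitivity (bottom_law 1 (scons k d) N).
  by rewrite bottom_lawS; apply: eq_tsum => M.
congr prb; apply/seteqP; split=> w /=.
  by case=> Mw H; split; [split|exact: (H 0%N)].
by case=> -[Mw _] dw; split=> // -[].
Qed.

End SteadyLaw.

(** * The quadrant *)

Section Quadrant.
Variables (R : realType) (C H : countType) (x0 : C * H).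
Variable X : C -> H -> C -> H -> nne R.
(* [rho r s d D] is the probability that the first [r] vertical and [s]
   horizontal edges entering the quadrant are [d] and [D]. *)
Variable rho : nat -> nat -> (nat -> C) -> (nat -> H) -> nne R.
Context (disp : measure_display) (Om : measurableType disp).
Variable P : probability Om R.

Definition quadrant_agree r s (p p' : nat -> nat -> C) (h h' : nat -> nat -> H) :=
  (forall i j, (i < r)%N -> (j <= s)%N -> p i j = p' i j) /\
  (forall i j, (i <= r)%N -> (j < s)%N -> h i j = h' i j).

Definition quadrant_weight r s (p : nat -> nat -> C) (h : nat -> nat -> H) : nne R :=
  rho r s (p ^~ 0%N) (h 0%N) *
  \prod_(j < s) \prod_(i < r) X (p i j) (h i j) (p i j.+1) (h i.+1 j).

Definition quadrant_model (p : Om -> nat -> nat -> C) (h : Om -> nat -> nat -> H) :=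
  [/\ forall i j, discrete_variable (fun w => p w i j),
      forall i j, discrete_variable (fun w => h w i j)
    & forall r s p' h', prb P [set w | quadrant_agree r s (p w) p' (h w) h'] =
        quadrant_weight r s p' h'].

Lemma quadrant_agree_measurable p h r s p' h' :
  (forall i j, discrete_variable (fun w => p w i j)) ->
  (forall i j, discrete_variable (fun w => h w i j)) ->
  measurable [set w : Om | quadrant_agree r s (p w) p' (h w) h'].
Proof.
move=> dp dh.
rewrite (_ : [set w | _] =
  [set w | forall i : 'I_r, [set w | forall j : 'I_s.+1, [set w | p w i j = p' i j] w] w] `&`
  [set w | forall i : 'I_r.+1, [set w | forall j : 'I_s, [set w | h w i j = h' i j] w] w]).
  by apply: measurableI; do 2 apply: measurable_forall_ord => ?; [exact: dp|exact: dh].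
apply/seteqP; split=> w /= [Hp Hh]; split=> i j.
- exact: (Hp i j (ltn_ord i) (ltn_ord j)).
- exact: (Hh i j (ltn_ord i) (ltn_ord j)).
- by move=> ir js; exact: (Hp (Ordinal ir) (Ordinal (js : (j < s.+1)%N))).
- by move=> ir js; exact: (Hh (Ordinal (ir : (i < r.+1)%N)) (Ordinal js)).
Qed.

(** The vertices that remain keep their weights, so only the entering law has to be recomputed, by
    summing out column 0; the hypothesis says that it is [rho] again. *)
Lemma quadrant_model_right p h :
  (forall r s d D, \tsum_k0 tsum (fun t : s.-tuple (C * H) =>
     rho r.+1 s (scons k0 d) (hconfs x0 t) *
     column_weight X s (scons k0 (colors x0 t)) (hconfs x0 t) D) = rho r s d D) ->
  quadrant_model p h ->
  quadrant_model (fun w i j => p w i.+1 j) (fun w i j => h w i.+1 j).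
Proof.
move=> rho_right [dp dh ph]; split=> [i j|i j|r s p' h']; [exact: dp|exact: dh|].
(* The edges lost by the shift: the one entering the column from below and, for each row, the
   vertical edge above and the horizontal edge to the left of its vertex. *)
have dX : discrete_variable (fun w => (p w 0%N 0%N,
    mktuple (fun j : 'I_s => (p w 0%N j.+1, h w 0%N j)))).
  apply: discrete_pair; first exact: dp.
  apply: (discrete_mktuple (X := fun (j : 'I_s) w => (p w 0%N j.+1, h w 0%N j))) => j.
  by apply: discrete_pair.
rewrite (prb_partition P dX); last exact: quadrant_agree_measurable.
rewrite /quadrant_weight -rho_right tsum_pair tsumMl.
apply: eq_tsum => k0; rewrite tsumMl; apply: eq_tsum => t.
pose p1 i j := if i is i'.+1 then p' i' j else scons k0 (colors x0 t) j.
pose h1 i j := if i is i'.+1 then h' i' j else hconfs x0 t j.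
rewrite (_ : _ `&` _ = [set w | quadrant_agree r.+1 s (p w) p1 (h w) h1]).
  rewrite ph /quadrant_weight -mulrA; congr (_ * _).
  under eq_bigr do rewrite big_ord_recl.
  by rewrite big_split.
apply/seteqP; split=> w /=.
  case=> -[Hp Hh] [pk ht].
  have tE j : (j < s)%N -> nth x0 t j = (p w 0%N j.+1, h w 0%N j).
    by move=> js; rewrite -ht (nth_mktuple _ _ (Ordinal js)).
  split=> -[|i] j ir js //=; [|exact: Hp|by rewrite /hconfs tE|exact: Hh].
  by case: j js => [|j] js //=; rewrite /colors tE.
case=> Hp Hh; split; first by split=> i j ir js; [exact: Hp|exact: Hh].
congr (_, _); first exact: (Hp 0%N 0%N).
apply: val_inj; apply: (@eq_from_nth _ x0); rewrite !size_tuple// => j js.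
rewrite (nth_mktuple _ _ (Ordinal js)) /= (Hp 0%N j.+1)// (Hh 0%N j)//=.
by rewrite /colors /hconfs -surjective_pairing.
Qed.

Lemma quadrant_model_up p h :
  (forall r s c D, \tsum_V0 tsum (fun t : r.-tuple (C * H) =>
     rho r s.+1 (colors x0 t) (scons V0 D) *
     row_weight X r (colors x0 t) (scons V0 (hconfs x0 t)) c) = rho r s c D) ->
  quadrant_model p h ->
  quadrant_model (fun w i j => p w i j.+1) (fun w i j => h w i j.+1).
Proof.
move=> rho_up [dp dh ph]; split=> [i j|i j|r s p' h']; [exact: dp|exact: dh|].
have dX : discrete_variable (fun w => (h w 0%N 0%N,
    mktuple (fun i : 'I_r => (p w i 0%N, h w i.+1 0%N)))).
  apply: discrete_pair; first exact: dh.
  apply: (discrete_mktuple (X := fun (i : 'I_r) w => (p w i 0%N, h w i.+1 0%N))) => i.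
  by apply: discrete_pair.
rewrite (prb_partition P dX); last exact: quadrant_agree_measurable.
rewrite /quadrant_weight -rho_up tsum_pair tsumMl.
apply: eq_tsum => V0; rewrite tsumMl; apply: eq_tsum => t.
pose p1 i j := if j is j'.+1 then p' i j' else colors x0 t i.
pose h1 i j := if j is j'.+1 then h' i j' else scons V0 (hconfs x0 t) i.
rewrite (_ : _ `&` _ = [set w | quadrant_agree r s.+1 (p w) p1 (h w) h1]).
  rewrite ph /quadrant_weight -mulrA; congr (_ * _).
  by rewrite big_ord_recl.
apply/seteqP; split=> w /=.
  case=> -[Hp Hh] [pk ht].
  have tE i : (i < r)%N -> nth x0 t i = (p w i 0%N, h w i.+1 0%N).
    by move=> ir; rewrite -ht (nth_mktuple _ _ (Ordinal ir)).
  split=> i -[|j] ir js //=; [by rewrite /colors tE|exact: Hp| |exact: Hh].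
  by case: i ir => [|i] ir //=; rewrite /hconfs tE.
case=> Hp Hh; split; first by split=> i j ir js; [exact: Hp|exact: Hh].
congr (_, _); first exact: (Hh 0%N 0%N).
apply: val_inj; apply: (@eq_from_nth _ x0); rewrite !size_tuple// => i ir.
rewrite (nth_mktuple _ _ (Ordinal ir)) /= (Hp i 0%N)// (Hh i.+1 0%N)//=.
by rewrite /colors /hconfs -surjective_pairing.
Qed.

(** Unlike coordinate sets, these are closed under intersection, as Dynkin's lemma requires. *)
Definition finite_dim (S : set ((nat -> C) * (nat -> H))) : Prop :=
  exists N, forall x y, (forall i, (i < N)%N -> x.1 i = y.1 i /\ x.2 i = y.2 i) ->
    S x -> S y.

(** A finite region is stored in a countable type, so that one can sum over its configurations.
    Outside the region the default [x0] is read. *)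
Definition region_p N (y : N.-tuple (N.+1.-tuple C) * N.+1.-tuple (N.-tuple H)) i j : C :=
  nth x0.1 (nth (nseq_tuple N.+1 x0.1) y.1 i) j.
Definition region_h N (y : N.-tuple (N.+1.-tuple C) * N.+1.-tuple (N.-tuple H)) i j : H :=
  nth x0.2 (nth (nseq_tuple N x0.2) y.2 i) j.

(** The value obtained depends only on [rho] and [X], hence is shared by all quadrant models with
    these data. *)
Lemma quadrant_model_finite_dim p h N (S : set ((nat -> C) * (nat -> H))) :
  (forall x y, (forall i, (i < N)%N -> x.1 i = y.1 i /\ x.2 i = y.2 i) ->
    S x -> S y) ->
  quadrant_model p h ->
  measurable [set w | S (p w ^~ 0%N, h w 0%N)] /\
  prb P [set w | S (p w ^~ 0%N, h w 0%N)] =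
  tsum (fun y : N.-tuple (N.+1.-tuple C) * N.+1.-tuple (N.-tuple H) =>
    `[< S (region_p y ^~ 0%N, region_h y 0%N) >]%:R *
    quadrant_weight N N (region_p y) (region_h y)).
Proof.
move=> SN [dp dh ph].
pose Y w := (mktuple (fun i : 'I_N => mktuple (fun j : 'I_N.+1 => p w i j)),
             mktuple (fun i : 'I_N.+1 => mktuple (fun j : 'I_N => h w i j))).
have dY : discrete_variable Y.
  apply: discrete_pair.
    apply: (discrete_mktuple (X := fun (i : 'I_N) w => mktuple (fun j : 'I_N.+1 => p w i j))) => i.
    by apply: (discrete_mktuple (X := fun (j : 'I_N.+1) w => p w i j)).
  apply: (discrete_mktuple (X := fun (i : 'I_N.+1) w => mktuple (fun j : 'I_N => h w i j))) => i.
  by apply: (discrete_mktuple (X := fun (j : 'I_N) w => h w i j)).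
have Yp w i j : (i < N)%N -> (j <= N)%N -> region_p (Y w) i j = p w i j.
  move=> iN jN; rewrite /region_p /Y /= (nth_mktuple _ _ (Ordinal iN)) /=.
  by rewrite (nth_mktuple _ _ (Ordinal (jN : (j < N.+1)%N))).
have Yh w i j : (i <= N)%N -> (j < N)%N -> region_h (Y w) i j = h w i j.
  move=> iN jN; rewrite /region_h /Y /= (nth_mktuple _ _ (Ordinal (iN : (i < N.+1)%N))) /=.
  by rewrite (nth_mktuple _ _ (Ordinal jN)).
have SY w : S (p w ^~ 0%N, h w 0%N) <-> S (region_p (Y w) ^~ 0%N, region_h (Y w) 0%N).
  by split; apply: SN => i iN /=; rewrite Yp ?Yh.
have SE : [set w | S (p w ^~ 0%N, h w 0%N)] =
    [set w | [set y | S (region_p y ^~ 0%N, region_h y 0%N)] (Y w)].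
  by apply/seteqP; split=> w /SY.
have mS : measurable [set w | S (p w ^~ 0%N, h w 0%N)].
  rewrite SE.
  exact: (discrete_variable_measurable [set y | S (region_p y ^~ 0%N, region_h y 0%N)] dY).
split=> //; rewrite (prb_partition P dY mS); apply: eq_tsum => y.
rewrite -ph; case: asboolP => Sy; last first.
  rewrite mul0r (_ : _ `&` _ = set0); first by apply: nnval_inj; rewrite /= measure0.
  by apply/seteqP; split=> // w [/= /SY + Ywy]; rewrite Ywy.
rewrite mul1r; congr prb; apply/seteqP; split=> w /=.
  by case=> _ <-; split=> i j iN jN; rewrite ?Yp ?Yh.
case=> Hp Hh; have Ywy : Y w = y.
  rewrite [RHS]surjective_pairing; congr (_, _).
    apply: eq_from_tnth => i; apply: eq_from_tnth => j.
    rewrite !tnth_mktuple (Hp i j) ?ltn_ord// -1?ltnS ?ltn_ord// /region_p.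
    by rewrite (tnth_nth x0.1) (tnth_nth (nseq_tuple N.+1 x0.1)).
  apply: eq_from_tnth => i; apply: eq_from_tnth => j.
  rewrite !tnth_mktuple (Hh i j) ?ltn_ord// -1?ltnS ?ltn_ord// /region_h.
  by rewrite (tnth_nth x0.2) (tnth_nth (nseq_tuple N x0.2)).
by split=> //; apply/SY; rewrite Ywy.
Qed.

(** Dynkin's lemma. Measurability of the two preimages is carried along because complements and
    disjoint unions need it. *)
Lemma quadrant_model_law p h p' h' :
  quadrant_model p h -> quadrant_model p' h' ->
  forall S, <<s finite_dim >> S ->
  P [set w | S (p w ^~ 0%N, h w 0%N)] = P [set w | S (p' w ^~ 0%N, h' w 0%N)].
Proof.
move=> m m'.
pose bX w := (p w ^~ 0%N, h w 0%N); pose bY w := (p' w ^~ 0%N, h' w 0%N).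
suff : <<s finite_dim >> `<=` [set S | [/\ measurable (bX @^-1` S),
    measurable (bY @^-1` S) & P (bX @^-1` S) = P (bY @^-1` S)]].
  by move=> sub S /sub[].
apply: lambda_system_subset => //.
- move=> A B [N hA] [N' hB]; exists (maxn N N') => x y xy [Ax Bx]; split.
    by apply: hA Ax => i iN; apply: xy; rewrite leq_max iN.
  by apply: hB Bx => i iN; apply: xy; rewrite leq_max iN orbT.
- apply/dynkin_lambda_system; split.
  + by rewrite /= !preimage_setT; split; [exact: measurableT|exact: measurableT|].
  + move=> A [mX mY PXY]; split; [exact: measurableC|exact: measurableC|].
    change (P (~` (bX @^-1` A)) = P (~` (bY @^-1` A))).
    by rewrite (probability_setC P mX) (probability_setC P mY) PXY.
  + move=> F tF HF.
    have mFX k : measurable (bX @^-1` F k) by case: (HF k).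
    have mFY k : measurable (bY @^-1` F k) by case: (HF k).
    have tFb (b : Om -> (nat -> C) * (nat -> H)) : trivIset setT (fun k => b @^-1` F k).
      by move=> k l _ _ [w Fw]; apply: tF => //; exists (b w).
    split; [exact: (bigcupT_measurable _ mFX)|exact: (bigcupT_measurable _ mFY)|].
    change (P (\bigcup_k (bX @^-1` F k)) = P (\bigcup_k (bY @^-1` F k))).
    rewrite (measure_bigcup P _ _ (fun k _ => mFX k) (tFb bX)).
    rewrite (measure_bigcup P _ _ (fun k _ => mFY k) (tFb bY)).
    by apply: eq_eseriesr => k _; case: (HF k).
- move=> S [N SN].
  have [mX PX] := quadrant_model_finite_dim SN m.
  have [mY PY] := quadrant_model_finite_dim SN m'.
  split=> //.
  by move/(congr1 nnval) : PX; rewrite -PY.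
Qed.

End Quadrant.

(** * From the vertex model to the quadrant *)

Section VertexModel.
Variables (R : realType) (n : nat).
Variable Wqueue : 'I_n -> vconf n -> hconf n -> vconf n -> hconf n -> R.
Variable Wqp : color n -> hconf n -> color n -> hconf n -> R.
Hypothesis n0 : (0 < n)%N.
Hypothesis hqueue : forall m, stochastic_queue_weight m (Wqueue m).
Hypothesis hqp : stochastic_qp_weight Wqp.
Context (disp : measure_display) (Om : measurableType disp).
Variables (P : probability Om R) (E : Om -> edges n).
Hypothesis hmodel : vertex_model P Wqueue Wqp E.

Notation Q := (queue_row Wqueue).
Local Notation bottom := (bottom_law P (fun w => edgesM (E w)) (fun i w => pv (E w) i 0)).
Local Notation rowdata := (vstate n * {ffun 'I_n.+1 -> hconf n})%type.

Definition queue_edge_row (M : vstate n) (h : {ffun 'I_n.+1 -> hconf n})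
    (N : vstate n) (V : hconf n) : nne R :=
  (h ord_max == hzero n)%:R * (h ord0 == V)%:R *
  \prod_(m < n) wqueue Wqueue m (M m) (h (lift ord0 m)) (N m)
    (h (widen_ord (leqnSn n) m)).

Definition row0 : rowdata := (empty_state n, [ffun=> hzero n]).
(** The datum of row [j] records the state leaving that row, so the state entering it is found one
    index earlier; [scons] supplies the initial one. *)
Definition row_state (M : vstate n) (t : seq rowdata) : nat -> vstate n :=
  scons M (fun j => (nth row0 t j).1).
Definition row_edges (t : seq rowdata) (j : nat) := (nth row0 t j).2.

Lemma queue_out_edges s D M :
  queue_out Q s D M = tsum (fun t : s.-tuple rowdata => \prod_(j < s)
    queue_edge_row (row_state M t j) (row_edges t j) (row_state M t j.+1) (D j)).
Proof.
elim: s D M => [|s IH] D M; first by rewrite tsum_tuple0 big_ord0.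
rewrite tsum_tupleS tsum_pair /=; apply: eq_tsum => N.
rewrite /queue_row /rowsum tsumMl; apply: eq_tsum => h.
rewrite IH tsumMr; apply: eq_tsum => t; rewrite big_ord_recl /=.
congr (_ * _); apply: eq_bigr => j _.
by case: j => -[|j] ltj.
Qed.

Definition boundary_law r s (d : nat -> color n) (D : nat -> hconf n) : nne R :=
  \tsum_M (bottom r d M * queue_out Q s D M).

(** The event is partitioned by all edges of the first [s] queue rows. Each consistent piece is an
    [agree] event, whose probability is the product of the vertex weights, and summing the queue
    part gives [queue_out]. *)
Lemma vertex_model_quadrant :
  quadrant_model (wqp Wqp) boundary_law P (fun w => pv (E w)) (fun w => ph (E w)).
Proof.
have [[mqv mqh mpv mph] adm prob] := hmodel.
have [W0 _ _] := hqp.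
split=> [i j|i j|r s p' h']; [exact: mpv|exact: mph|].
pose st w j : vstate n := [ffun m => qv (E w) m j].
pose hr w j : {ffun 'I_n.+1 -> hconf n} := [ffun p : 'I_n.+1 => qh (E w) p j].
have dst j : discrete_variable (st ^~ j).
  by apply: (discrete_ffun (X := fun m w => qv (E w) m j)) => m; exact: mqv.
have dhr j : discrete_variable (hr ^~ j).
  by apply: (discrete_ffun (X := fun (p : 'I_n.+1) w => qh (E w) p j)) => p; exact: mqh.
have dX : discrete_variable (fun w => (edgesM (E w),
    mktuple (fun j : 'I_s => (st w j.+1, hr w j)))).
  apply: discrete_pair; first exact: (dst 0%N).
  apply: (discrete_mktuple (X := fun (j : 'I_s) w => (st w j.+1, hr w j))) => j.
  by apply: discrete_pair.
rewrite (prb_partition P dX); last by apply: quadrant_agree_measurable.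
rewrite tsum_pair /quadrant_weight /boundary_law tsumMl; apply: eq_tsum => M0.
rewrite queue_out_edges tsumMr tsumMl; apply: eq_tsum => t.
have vE w j : vertical_state (st w j).
  by apply/forallP => m; apply/verticalP; rewrite ffunE; case: (adm w) => + _ _; exact.
have tE w : (edgesM (E w), mktuple (fun j : 'I_s => (st w j.+1, hr w j))) = (M0, t) <->
    edgesM (E w) = M0 /\ forall j, (j < s)%N ->
      row_state M0 t j.+1 = st w j.+1 /\ row_edges t j = hr w j.
  split=> [[-> tw]|[-> Ht]].
    by split=> // j js; rewrite /row_edges /= -tw (nth_mktuple _ _ (Ordinal js)).
  congr (_, _); apply: eq_from_tnth => j; rewrite tnth_mktuple (tnth_nth row0).
  have [] := Ht j (ltn_ord j); rewrite /row_edges /= => <- <-.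
  by rewrite -surjective_pairing.
have edgesM_st w : edgesM (E w) = st w 0%N by [].
have qh_out w j : hr w j ord_max = hzero n /\ hr w j ord0 = ph (E w) 0%N j.
  by rewrite !ffunE; case: (adm w) => _ -> ->.
(* For data that violate verticality or the outer horizontal edges, the event is empty and the
   weight on the other side vanishes too. *)
have [/andP[vM0 /forallP okt]|nok] := boolP (vertical_state M0 && [forall j : 'I_s,
    [&& vertical_state (row_state M0 t j.+1), row_edges t j ord_max == hzero n
      & row_edges t j ord0 == h' 0%N j]]); last first.
  transitivity (0 : nne R).
    rewrite (_ : _ `&` _ = set0); first by apply: nnval_inj; exact: measure0.
    apply/seteqP; split=> // w [/= [_ Hh] /tE[EM Ht]]; move/negP: nok; apply.
    have -> : vertical_state M0 by rewrite -EM edgesM_st.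
    apply/forallP => j; have [-> ->] := Ht j (ltn_ord j).
    by have [-> ->] := qh_out w j; rewrite vE Hh ?eqxx.
  move: nok; rewrite negb_and => /orP[nv|].
    rewrite [X in X * _ * _](_ : _ = 0) ?mul0r//.
    rewrite /bottom_law (_ : bottom_event _ _ _ _ _ = set0).
      by apply: nnval_inj; exact: measure0.
    by apply/seteqP; split=> // w [EM _]; move: nv; rewrite -EM edgesM_st vE.
  rewrite negb_forall => /existsP[j nj].
  rewrite (bigD1 j)//= (_ : queue_edge_row _ _ _ _ = 0) ?mul0r ?mulr0 ?mul0r//.
  move: nj; rewrite !negb_and => /or3P[|/negPf nj|/negPf nj]; last 2 first.
  - by rewrite /queue_edge_row nj !mul0r.
  - by rewrite /queue_edge_row nj mulr0 mul0r.
  rewrite negb_forall => /existsP[m /negPf nm].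
  by rewrite /queue_edge_row (bigD1 m)//= /wqueue nm andbF !mul0r mulr0.
(* Above row [s] the values serve only to make [e] admissible. There edge 0 must match the quadrant
   and edge [n] must be empty, which is consistent since [n] is positive. *)
pose e := Edges (fun m j => if (j <= s)%N then row_state M0 t j m else vempty m)
  (fun p j => if (j < s)%N then row_edges t j (inord p)
              else if p == 0%N then h' 0%N j else hzero n) p' h'.
have vrow j : (j <= s)%N -> vertical_state (row_state M0 t j).
  by case: j => [|j] js //; have /and3P[] := okt (Ordinal js).
have adm_e : admissible e.
  split=> [m j|j|j] /=.
  - case: ifP => js; first by apply/verticalP; exact: (forallP (vrow j js)).
    by move=> i; rewrite ffunE; case: (i == m).
  - case: ifP => js; last by rewrite gtn_eqF.
    have /and3P[_ /eqP <- _] := okt (Ordinal js).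
    by congr (row_edges _ _ _); apply: val_inj; rewrite /= inordK.
  - case: ifP => js //; have /and3P[_ _ /eqP <-] := okt (Ordinal js).
    by congr (row_edges _ _ _); apply: val_inj; rewrite /= inordK.
have -> : [set w | quadrant_agree r s (pv (E w)) p' (ph (E w)) h'] `&`
    [set w | (edgesM (E w), mktuple (fun j : 'I_s => (st w j.+1, hr w j))) = (M0, t)] =
    [set w | agree r s (E w) e].
  apply/seteqP; split=> w /=.
    case=> -[Hp Hh] /tE[EM Ht]; split=> //= [m [|j] js|p j pn js].
    - by rewrite js -EM ffunE.
    - by rewrite js; have [-> _] := Ht j js; rewrite ffunE.
    - by rewrite js; have [_ ->] := Ht j js; rewrite ffunE inordK.
  case=> /= Hqv Hqh Hp Hh; split=> //; apply/tE; split.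
    by apply/ffunP => m; rewrite ffunE Hqv.
  move=> j js; split; apply/ffunP => m; rewrite ffunE.
    by rewrite Hqv// js.
  by rewrite Hqh ?js ?inord_val// -ltnS ltn_ord.
have -> : bottom r (p' ^~ 0%N) M0 = prb P [set w | agree r 0 (E w) e].
  congr prb; apply/seteqP; split=> w /=.
    case=> EM Hp; split=> //= [m j|i j ir]; rewrite leqn0 => /eqP -> /=.
      by rewrite -EM ffunE.
    exact: Hp.
  case=> /= Hqv _ Hp _; split=> [|i ir]; last exact: Hp.
  by apply/ffunP => m; rewrite ffunE Hqv.
have vqv m j : vertical m (qv e m j) by case: adm_e.
have qW j m : 0 <= Wqueue m (qv e m j) (qh e m.+1 j) (qv e m j.+1) (qh e m j).
  by have [+ _ _] := hqueue m; apply.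
have -> : prb P [set w | agree r s (E w) e] = prb P [set w | agree r 0 (E w) e] *
    nnr (\prod_(j < s) (\prod_(m < n)
      Wqueue m (qv e m j) (qh e m.+1 j) (qv e m j.+1) (qh e m j) *
      \prod_(i < r) Wqp (pv e i j) (ph e i j) (pv e i j.+1) (ph e i.+1 j))).
  apply: nnval_inj; rewrite nnvalM nnval_nnr; first exact: prob.
  apply: prodr_ge0 => j _; apply: mulr_ge0; apply: prodr_ge0 => i _.
    exact: qW.
  exact: W0.
rewrite -mulrA nnr_prod -big_split /=; congr (_ * _).
apply: eq_bigr => j _; rewrite nnrM !nnr_prod; congr (_ * _).
rewrite /queue_edge_row; have /and3P[_ -> ->] := okt j; rewrite !mul1r.
apply: eq_bigr => m _; rewrite /wqueue.
have v1 : verticalb m (row_state M0 t j m).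
  by apply: (forallP (vrow j _)); exact: ltnW.
have v2 : verticalb m (row_state M0 t j.+1 m) by exact: (forallP (vrow _ _)).
rewrite v1 v2 mul1r ltn_ord (ltnW (ltn_ord j)).
congr (nnr (Wqueue _ _ (row_edges _ _ _) _ (row_edges _ _ _))); apply: val_inj.
  by rewrite /= inordK ?lift0// ltnS ltn_ord.
by rewrite /= inordK// ltnS ltnW.
Qed.

End VertexModel.

(** * Equality of laws for all shifted quadrants *)

Lemma coordinate_sets_finite_dim n (S : set ((nat -> color n) * (nat -> hconf n))) :
  <<s @coordinate_sets n >> S -> <<s @finite_dim (color n) (hconf n) >> S.
Proof.
apply: sub_sigma_algebra2 => {}S [[i [c ->]]|[j [D ->]]].
  by exists i.+1 => x y xy /= <-; case: (xy i (ltnSn i)).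
by exists j.+1 => x y xy /= <-; case: (xy j (ltnSn j)).
Qed.

Theorem theorem7p6 (R : realType) (n : nat) (q : R) (alpha nu : 'I_n -> R)
    (Wqueue : 'I_n -> vconf n -> hconf n -> vconf n -> hconf n -> R)
    (Wqp : color n -> hconf n -> color n -> hconf n -> R)
    (disp : measure_display) (Om : measurableType disp) (P : probability Om R)
    (E : Om -> edges n)
    (hn : (1 <= n)%N)
    (hq : 0 <= q < 1)
    (halpha : forall i j : 'I_n, (i < j)%N -> alpha j < alpha i)
    (halpha0 : forall i, 0 < alpha i)
    (hnu : forall i, 0 <= nu i <= alpha i)
    (hqueue : forall m, stochastic_queue_weight m (Wqueue m))
    (hqp : stochastic_qp_weight Wqp)
    (hYB : forall m,
       yang_baxter m (line_weight q (alpha m) (nu m) m) (Wqueue m) Wqp)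
    (hsteady : steady_state q alpha nu P
       (fun w => edgesM (E w)) (fun i w => pv (E w) i 0))
    (hmodel : vertex_model P Wqueue Wqp E) :
  let dvert (w : Om) := fun i : nat => pv (E w) i 0 in
  let V (w : Om) := fun j : nat => ph (E w) 0 j in
  let dvert' (w : Om) := fun i : nat => pv (E w) i 1 in
  let V' (w : Om) := fun j : nat => ph (E w) 1 j in
  [/\ same_law P (fun w => (dvert w, V w))
                 (fun w => (dvert' w, fun j => V w j.+1)),
      same_law P (fun w => (dvert' w, fun j => V w j.+1))
                 (fun w => (fun i => dvert w i.+1, V' w))
    & forall I J : nat,
        same_law P (fun w => boundary I J (E w)) (fun w => boundary 0 0 (E w))].
Proof.
have dM : discrete_variable (fun w => edgesM (E w)).
  have [[mqv _ _ _] _ _] := hmodel.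
  by apply: (discrete_ffun (X := fun m w => qv (E w) m 0%N)) => m; exact: mqv.
have dd i : discrete_variable (fun w => pv (E w) i 0%N).
  by have [[_ _ mpv _] _ _] := hmodel; exact: mpv.
(* With [r = 0] no exit is constrained, so the sequence of colors is a dummy. *)
pose f := bottom_law P (fun w => edgesM (E w)) (fun i w => pv (E w) i 0%N)
  0 (fun=> None).
pose rho := boundary_law Wqueue P E.
have rhoE r s d D : rho r s d D = \tsum_M
    (line_law (line_row q alpha nu) r d f M * queue_out (queue_row Wqueue) s D M).
  apply: eq_tsum => M; congr (_ * _).
  rewrite (bottom_law_line hq halpha0 hnu dM dd hsteady).
  by congr line_law; apply/funext => N; exact: bottom_law_ext.
have fgood M : f M != 0 -> good_state M.
  exact: (bottom_law_good hq halpha0 hnu hsteady).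
have fQ : queue_step (queue_row Wqueue) f = f.
  apply/funext; apply: (queue_stationary hq halpha0 hnu hqueue hqp hYB fgood).
    exact: bottom_law0_mass.
  exact: (bottom_law0_invariant hq halpha0 hnu dM dd hsteady).
have exch := row_exchange hq halpha0 hnu hqueue hqp hYB.
pose x0 : color n * hconf n := (None, hzero n).
have right r s d D : \tsum_k0 tsum (fun t : s.-tuple (color n * hconf n) =>
    rho r.+1 s (scons k0 d) (hconfs x0 t) *
    column_weight (wqp Wqp) s (scons k0 (colors x0 t)) (hconfs x0 t) D) = rho r s d D.
  rewrite rhoE -(column_law x0 exch (ok := @vertical_state n)).
  - by apply: eq_tsum => k0; apply: eq_tsum => t; rewrite rhoE.
  - by move=> M; exact: line_row_stoch.
  - by move=> M N k; exact: line_row_vertical.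
  - by move=> M N V; exact: queue_row_vertical.
  - by move=> M /fgood/andP[].
have up r s c D : \tsum_V0 tsum (fun t : r.-tuple (color n * hconf n) =>
    rho r s.+1 (colors x0 t) (scons V0 D) *
    row_weight (wqp Wqp) r (colors x0 t) (scons V0 (hconfs x0 t)) c) = rho r s c D.
  rewrite rhoE.
  (* A queue row is inserted at the bottom of the stack by invariance of [f]; [row_law], read
     backwards, brings it to the top, where it becomes the first row of [queue_out]. *)
  under [RHS]eq_tsum => N do rewrite -{1}fQ -(row_law x0 exch) tsumMl.
  rewrite [RHS]tsumC; apply: eq_tsum => V0.
  under [RHS]eq_tsum => N do rewrite tsumMl.
  rewrite [RHS]tsumC; apply: eq_tsum => t.
  under [RHS]eq_tsum => N do rewrite mulrAC.
  rewrite -tsumMl; congr (_ * _); rewrite rhoE /=.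
  under eq_tsum => M do rewrite tsumMr.
  rewrite tsumC; apply: eq_tsum => N; rewrite tsumMl.
  by apply: eq_tsum => M; rewrite mulrA.
have base : quadrant_model (wqp Wqp) rho P (fun w => pv (E w)) (fun w => ph (E w)).
  exact: vertex_model_quadrant.
(* The entering law is the same [rho] after each shift, so the one-step shifts can be iterated. *)
have shifted I J : quadrant_model (wqp Wqp) rho P
    (fun w i j => pv (E w) (I + i) (J + j)) (fun w i j => ph (E w) (I + i) (J + j)).
  elim: I => [|I /(quadrant_model_right right) m].
    elim: J => [|J /(quadrant_model_up up) m]; first exact: base.
    by move: m; congr quadrant_model; apply/funext => w; apply/funext => i;
      apply/funext => j; rewrite addSnnS.
  by move: m; congr quadrant_model; apply/funext => w; apply/funext => i;
    apply/funext => j; rewrite addSnnS.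
have law I J : same_law P (fun w => boundary I J (E w)) (fun w => boundary 0 0 (E w)).
  move=> S /coordinate_sets_finite_dim sS.
  have -> : (fun w => boundary I J (E w)) = (fun w =>
      (fun i => pv (E w) (I + i) (J + 0), fun j => ph (E w) (I + 0) (J + j))).
    by apply/funext => w; congr (_, _); apply/funext => k; rewrite addn0.
  exact: (quadrant_model_law x0 (shifted I J) base sS).
move=> dvert V dvert' V'; split.
- by move=> S sS; rewrite -(law 0%N 1%N S sS).
- by move=> S sS; rewrite (law 0%N 1%N S sS) -(law 1%N 0%N S sS).
- exact: law.
Qed.
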